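(* Let $(U_k)_{k\ge1}$ be i.i.d. almost surely positive random variables distributed as $U$, with tail function $Q(x)=\mathbb{P}(U>x)$, and assume: the maximum of the support of the distribution of $U$ is $1$ and there exists $\alpha\in[0,2)$ such that $\log Q(1-u)=\alpha\log u+o(\log u)$ as $u\to0^+$. Let $(v_{N+1})_{N\ge1}$ be a deterministic sequence of positive reals. For each $N$, let $V_1\le\dots\le V_N$ be the order statistics of $(U_1,\dots,U_N)$ and, conditionally on $(V_1,\dots,V_N)$, let $(X_{i,j})_{1\le i<j\le N+1}$ be independent Bernoulli variables with $\mathbb{P}_V(X_{i,j}=1)=\frac{V_i}{V_i+V_j}$, where $V_{N+1}:=v_{N+1}$; set $X_{j,i}=1-X_{i,j}$ and $S_i=\sum_{j=1,\,j\ne i}^{N}X_{i,j}$ for $i\in\{1,\dots,N+1\}$ (so the total score of player $i\le N$ is $S_i+X_{i,N+1}$ and that of player $N+1$ is $S_{N+1}$). Let \[\vartheta_U=\mathbb{E}\Big[\frac{U}{(U+1)^2}\Big],\qquad \epsilon_N=\sqrt{\frac{2-\alpha}{\vartheta_U}\,\frac{\log N}{N}}.\] (i) If $\liminf_{N\to\infty}\frac{v_{N+1}-1}{\epsilon_N}>1$, then $\mathbb{P}$-almost surely \[\mathbb{P}_V(\text{player } N+1 \text{ wins})\ \ge\ \mathbb{P}_V\Big(S_{N+1}>1+\max_{1\le i\le N}S_i\Big)\xrightarrow[N\to\infty]{}1.\] (ii) If $\limsup_{N\to\infty}\frac{v_{N+1}-1}{\epsilon_N}<1$, then $\mathbb{P}$-almost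 surely \[\mathbb{P}_V(\text{player } N+1 \text{ does not win})\ \ge\ \mathbb{P}_V\Big(S_{N+1}<\max_{1\le i\le N}S_i\Big)\xrightarrow[N\to\infty]{}1.\]
   Context: $\mathbb{P}$ is the annealed probability and $\mathbb{P}_V$ the quenched probability given $(V_1,\dots,V_N)$. $X_{i,j}=1$ means player $i$ beats player $j$. ''Player $N+1$ wins'' means his total score $S_{N+1}$ is at least the total score $S_i+X_{i,N+1}$ of every other player $i\le N$. *)

(* Defs.v *)
From HB Require Import structures.
From mathcomp Require Import all_boot all_order all_algebra.
From mathcomp Require Import all_classical all_reals all_analysis.
Set Implicit Arguments. Unset Strict Implicit. Unset Printing Implicit Defensive.
Import Order.TTheory GRing.Theory Num.Theory.
Import numFieldNormedType.Exports.
Local Open Scope classical_set_scope.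
Local Open Scope ring_scope.

(* Mutual independence of the family (U k)_k together with identical distribution.
   Independence: for every n and every family of Borel sets B_0,...,B_{n-1}
   (taking B_k = setT removes index k, so this covers every finite subfamily),
   P(/\_{k<n} U_k in B_k) = prod_{k<n} P(U_k in B_k).
   Identical distribution: P(U_k in B) = P(U_0 in B) for every Borel B. *)
Definition iid_RVs (R : realType) (d : measure_display) (T : measurableType d)
  (P : probability T R) (U : nat -> {RV P >-> R}) : Prop :=
  (forall (n : nat) (B : nat -> set R), (forall k, measurable (B k)) ->
     P (\big[setI/setT]_(k < n) (U k @^-1` B k)) =
     (\prod_(k < n) P (U k @^-1` B k))%E) /\
  (forall (k : nat) (B : set R), measurable B ->
     P (U k @^-1` B) = P (U 0%N @^-1` B)).

Definition tailQ (R : realType) (d : measure_display) (T : measurableType d)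
  (P : probability T R) (X : T -> R) (x : R) : R :=
  fine (P [set w | x < X w]).

Definition thetaU (R : realType) (d : measure_display) (T : measurableType d)
  (P : probability T R) (X : T -> R) : R :=
  fine (\int[P]_w ((X w / (X w + 1) ^+ 2)%:E))%E.

Definition epsN (R : realType) (alpha theta : R) (N : nat) : R :=
  Num.sqrt ((2 - alpha) / theta * (ln (N%:R) / N%:R)).

(* Players 1..N are the indices i : 'I_N.+1 with i < N; player N+1 is ord_max.
   An outcome is x : {ffun 'I_N.+1 * 'I_N.+1 -> bool}; for i < j, x (i,j) is
   X_{i,j} (true = i beats j); the entries with i >= j carry no information and
   are forced to false by the weight below. *)
Definition outcome (N : nat) := {ffun 'I_N.+1 * 'I_N.+1 -> bool}.

Definition beats (N : nat) (x : outcome N) (i j : 'I_N.+1) : nat :=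
  if (i < j)%N then nat_of_bool (x (i, j))
  else if (j < i)%N then nat_of_bool (~~ x (j, i)) else 0%N.

Definition score (N : nat) (x : outcome N) (i : 'I_N.+1) : nat :=
  (\sum_(j < N.+1 | (j < N)%N && (j != i)) beats x i j)%N.

(* Quenched probability weight of an outcome, for strengths s : conditionally on
   the strengths, the X_{i,j} (i<j) are independent Bernoulli(s_i/(s_i+s_j)). *)
Definition tweight (R : realType) (N : nat) (s : 'I_N.+1 -> R) (x : outcome N) : R :=
  \prod_(p : 'I_N.+1 * 'I_N.+1)
     (if (p.1 < p.2)%N then
        (if x p then s p.1 / (s p.1 + s p.2) else s p.2 / (s p.1 + s p.2))
      else (if x p then 0 else 1)).

Definition qprob (R : realType) (N : nat) (s : 'I_N.+1 -> R) (E : pred (outcome N)) : R :=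
  \sum_(x : outcome N | E x) tweight s x.

(* strengths: V_1 <= ... <= V_N the order statistics of U_1..U_N (= U 0..U (N-1)),
   and V_{N+1} = vN *)
Definition strengths (R : realType) (N : nat) (u : nat -> R) (vN : R) : 'I_N.+1 -> R :=
  fun i => if (i < N)%N
           then nth 0 (sort (fun a b : R => a <= b) [seq u k | k <- iota 0 N]) i
           else vN.

Definition wins (N : nat) : pred (outcome N) :=
  fun x => [forall i : 'I_N.+1, (i < N)%N ==> (score x i + beats x i ord_max <= score x ord_max)%N].

Definition strong_win (N : nat) : pred (outcome N) :=
  fun x => (1 + \max_(i < N.+1 | (i < N)%N) score x i < score x ord_max)%N.

Definition not_wins (N : nat) : pred (outcome N) := fun x => ~~ wins x.

Definition strong_lose (N : nat) : pred (outcome N) :=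
  fun x => (score x ord_max < \max_(i < N.+1 | (i < N)%N) score x i)%N.

(* Main.v *)
(* With n = N, r = sqrt (log N / N) and f(v) = sum_j v / (v + V_j), the score of
   a player of strength v has mean about f(v), and for v near 1 its variance is
   about n theta.  There are about N^(1 - alpha/2) players within O(r) of
   strength 1, and a Gaussian deviation of size x n r has probability about
   N^(- x^2 / (2 theta)); so their best score is f(1) + e0 theta n r with
   e0^2 theta = 2 - alpha, which is f(1 + eps_N) to first order.

   Upper half: a union bound, the weaker players having too small a mean.
   Lower half: the second moment method.  The events "S_i >= t" and "S_k >= t"
   share only the match (i, k), which helps one player exactly when it hurts the
   other, so they are negatively correlated and P(no S_i >= t) is at most
   1 / sum_i P(S_i >= t).

   The strengths enter through two quantities only: the average of
   V / (V + 1)^2 and the number of strengths above 1 - K r.  The pattern of the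
   events "U_k in B" is again a product of Bernoulli laws, so that Chernoff
   bounds and the Borel-Cantelli lemma control both almost surely. *)

Require Import Defs.
From HB Require Import structures.
From mathcomp Require Import all_boot all_order all_algebra.
From mathcomp Require Import all_classical all_reals all_analysis.
From mathcomp Require Import measurable_realfun.
From mathcomp Require Import ring lra.
Import Order.TTheory GRing.Theory Num.Theory.
Import numFieldNormedType.Exports.
Local Open Scope classical_set_scope.
Local Open Scope ring_scope.

(** * Product Bernoulli laws *)

(** Every tilt has the form [lam = k * rate N] and every threshold the form [f 1 + b * N * rate N].
    Since [lnn N = N * rate N ^+ 2], the mean and the variance of a score enter the exponent as
    [lnn N] times a term linear, respectively quadratic, in [k], and the cubic error as [lnn N]
    times a multiple of [k ^+ 3 * rate N], which is negligible. Each bound becomes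
    [expR (lnn N * A N)] with [A] convergent, and only the sign of the limit matters; the room comes
    from placing [b] strictly between [e0 * theta] and [c * e0 * theta]. The obstacle is that the
    exponent of a strong player has to balance the number N^(1 - alpha/2) of such players exactly.
    The variance bound [N / 4] would lose this balance, so the moment generating function is needed
    to second order, from both sides. For the challenger and for the weak players the exponent has
    room to spare, and [N / 4] is enough. The quenched bounds are deterministic in the strengths;
    the randomness of [U] intervenes only through an event of probability one. *)

Definition bweight {R : realType} {I : finType} (p : I -> R)
    (x : {ffun I -> bool}) : R :=
  \prod_i (if x i then p i else 1 - p i).

Definition bmean {R : realType} {I : finType} (p : I -> R)
    (F : {ffun I -> bool} -> R) : R :=
  \sum_x bweight p x * F x.

Section BernoulliProduct.
Context {R : realType} {I : finType} (p : I -> R).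
Hypothesis p01 : forall i, 0 <= p i <= 1.

Lemma bweight_ge0 x : 0 <= bweight p x.
Proof.
apply: prodr_ge0 => i _; have /andP[p0 p1] := p01 i.
by case: (x i); rewrite ?subr_ge0.
Qed.

Lemma bmean_prod_all (g : I -> bool -> R) :
  bmean p (fun x => \prod_i g i (x i)) =
  \prod_i (p i * g i true + (1 - p i) * g i false).
Proof.
transitivity (\prod_i \sum_(b : bool) (if b then p i else 1 - p i) * g i b).
  rewrite bigA_distr_bigA; apply: eq_bigr => f _.
  by rewrite /bweight -big_split.
by apply: eq_bigr => i _; rewrite big_bool.
Qed.

Lemma eq_bmean F G : F =1 G -> bmean p F = bmean p G.
Proof. by move=> FG; apply: eq_bigr => x _; rewrite FG. Qed.

Lemma bmean_le F G : (forall x, F x <= G x) -> bmean p F <= bmean p G.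
Proof.
by move=> FG; apply: ler_sum => x _; rewrite ler_wpM2l ?bweight_ge0.
Qed.

Lemma bmean_cst c : bmean p (fun=> c) = c.
Proof.
rewrite /bmean -mulr_suml.
have -> : \sum_x bweight p x = bmean p (fun x => \prod_(i : I) 1).
  by apply: eq_bigr => x _; rewrite big1 ?mulr1.
rewrite (bmean_prod_all (fun _ _ => 1)) big1 ?mul1r// => i _.
by rewrite !mulr1 addrC subrK.
Qed.

Lemma bmeanD F G : bmean p (fun x => F x + G x) = bmean p F + bmean p G.
Proof. by rewrite -big_split; apply: eq_bigr => x _; rewrite mulrDr. Qed.

Lemma bmeanZ c F : bmean p (fun x => c * F x) = c * bmean p F.
Proof. by rewrite mulr_sumr; apply: eq_bigr => x _; rewrite mulrCA. Qed.

Lemma bmean_sum (J : Type) (r : seq J) (Q : pred J) F :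
  bmean p (fun x => \sum_(j <- r | Q j) F j x) = \sum_(j <- r | Q j) bmean p (F j).
Proof.
rewrite exchange_big /=; apply: eq_bigr => x _.
by rewrite mulr_sumr.
Qed.

(** A score reads only the coordinates of one player's matches, hence the subfamily [e]. Injectivity
    leaves at most one factor per coordinate, and a coordinate that no [j] selects integrates to
    total mass 1. *)
Lemma bmean_prod (J : finType) (Q : pred J) (e : J -> I) (h : J -> bool -> R) :
  {in Q &, injective e} ->
  bmean p (fun x => \prod_(j | Q j) h j (x (e j))) =
  \prod_(j | Q j) (p (e j) * h j true + (1 - p (e j)) * h j false).
Proof.
move=> einj.
pose g i b := \prod_(j | Q j && (e j == i)) h j b.
transitivity (bmean p (fun x => \prod_i g i (x i))).
  apply: eq_bmean => x; rewrite (partition_big e xpredT)//=.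
  by apply: eq_bigr => i _; apply: eq_bigr => j /andP[_ /eqP->].
rewrite bmean_prod_all (partition_big e xpredT)//=; apply: eq_bigr => i _.
rewrite /g; have [j /andP[Qj /eqP ej]|noj] := pickP (fun j => Q j && (e j == i)).
  rewrite !(big_pred1 j) ?ej// => k /=; apply/andP/eqP.
  - by move=> [Qk /eqP ek]; apply: einj => //; rewrite ek ej.
  - by move=> ->; rewrite ej eqxx.
  - by move=> [Qk /eqP ek]; apply: einj => //; rewrite ek ej.
  - by move=> ->; rewrite ej eqxx.
  - by move=> [Qk /eqP ek]; apply: einj => //; rewrite ek ej.
  - by move=> ->; rewrite ej eqxx.
by rewrite !big_pred0 // !mulr1 addrC subrK.
Qed.

Lemma bmean_markov (S : {ffun I -> bool} -> R) (t lam : R) : 0 <= lam ->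
  bmean p (fun x => (t <= S x)%R%:R) <= expR (- (lam * t)) * bmean p (fun x => expR (lam * S x)).
Proof.
move=> lam0; rewrite -bmeanZ; apply: bmean_le => x; rewrite -expRD.
have [tS|_] := boolP (t <= S x); last exact: expR_ge0.
by rewrite -expR0 ler_expR addrC subr_ge0 ler_wpM2l.
Qed.

Lemma bmean_markov_le (S : {ffun I -> bool} -> R) (t lam : R) : 0 <= lam ->
  bmean p (fun x => (S x <= t)%R%:R) <= expR (lam * t) * bmean p (fun x => expR (- lam * S x)).
Proof.
move=> lam0; rewrite -bmeanZ; apply: bmean_le => x; rewrite -expRD.
have [tS|_] := boolP (S x <= t); last exact: expR_ge0.
by rewrite -expR0 ler_expR mulNr subr_ge0 ler_wpM2l.
Qed.

End BernoulliProduct.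

(** * Second-order bounds for the exponential and the Bernoulli moment generating function *)

Section ExpBounds.
Context {R : realType}.
Implicit Types x y : R.

Lemma expR_le_inv x : x < 1 -> expR x <= (1 - x)^-1.
Proof.
move=> x1; rewrite -[x in expR x]opprK expRN lef_pV2 ?posrE ?expR_gt0 ?subr_gt0//.
exact: expR_ge1Dx.
Qed.

Lemma expR_sub1x y : `|y| <= 2^-1 -> 0 <= expR y - 1 - y <= 2 * y ^+ 2.
Proof.
rewrite ler_norml => /andP[y1 y2]; apply/andP; split.
  by rewrite -addrA -opprD subr_ge0 expR_ge1Dx.
have y3 : 0 < 1 - y by lra.
have : expR y <= (1 - y)^-1 by apply: expR_le_inv; lra.
move=> h; have h2 : (1 - y)^-1 <= 1 + y + 2 * y ^+ 2.
  rewrite -[_^-1]mul1r ler_pdivrMr//.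
  have : 0 <= y ^+ 2 * (1 - 2 * y) by rewrite mulr_ge0 ?sqr_ge0//; lra.
  by move=> ?; nra.
lra.
Qed.

(** Mean value theorem for the remainder: its derivative [expR z - 1 - z] is controlled by the
    quadratic bound [expR_sub1x]. *)
Lemma expR_taylor2 y : `|y| <= 2^-1 ->
  `|expR y - (1 + y + y ^+ 2 / 2)| <= 2 * `|y| ^+ 3.
Proof.
move=> yle; pose g (z : R) : R := expR z - (1 + z + z ^+ 2 / 2).
pose g' (z : R) : R := expR z - 1 - z.
have dg (z : R) : is_derive z 1 g (g' z).
  by apply: is_derive_eq; rewrite /GRing.scale /g' /=; field.
have bnd (z : R) : `|z| <= `|y| -> `|g' z| <= 2 * `|y| ^+ 2.
  move=> zy; have /expR_sub1x/andP[z1 z2] : `|z| <= 2^-1 by apply: le_trans yle.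
  rewrite ger0_norm//; apply: le_trans z2 _; rewrite ler_wpM2l//.
  by rewrite real_normK ?num_real// -(real_normK (num_real z)) -(real_normK (num_real y)) lerXn2r ?nnegrE.
have cg : continuous g.
  move=> t; have /derivable1_diffP/differentiable_continuous : derivable g t 1.
    exact: (@ex_derive _ _ _ _ _ _ _ (dg t)).
  exact.
have g0 : g 0 = 0 by rewrite /g expR0; lra.
have [c cy gc] : exists2 c, `|c| <= `|y| & g y = g' c * y.
  have [->|yn0] := eqVneq y 0; first by exists 0; rewrite // g0 mulr0.
  have [y0|y0] := ltP 0 y.
  - have [c /=] := @MVT R g g' 0 y y0 (fun z _ => dg z) (continuous_subspaceT cg).
    rewrite in_itv/= => /andP[c0 cy]; rewrite g0 !subr0 => gy.
    by exists c => //; rewrite !gtr0_norm ?ltW.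
  - have {}y0 : y < 0 by rewrite lt_neqAle yn0.
    have [c /=] := @MVT R g g' y 0 y0 (fun z _ => dg z) (continuous_subspaceT cg).
    rewrite in_itv/= => /andP[cy c0]; rewrite g0 !sub0r mulrN => /oppr_inj gy.
    by exists c => //; rewrite !ltr0_norm ?lerN2 1?ltW.
rewrite -/(g y) gc normrM exprSr mulrA ler_wpM2r//; exact: bnd.
Qed.

(** Factoring out [expR (lam * q)] leaves the centred transform [1 + z], where [z] is the variance
    term up to [2 * L ^+ 3] by Taylor. The upper bound is [1 + z <= expR z]. The lower one is
    [expR (z - z ^+ 2) <= 1 + z], and [z ^+ 2 <= L ^+ 3] raises the constant from 2 to 3. *)
Lemma bernoulli_mgf (q lam : R) : 0 <= q <= 1 -> `|lam| <= 2^-1 ->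
  expR (lam * q + lam ^+ 2 / 2 * (q * (1 - q)) - 3 * `|lam| ^+ 3)
    <= q * expR lam + (1 - q)
    <= expR (lam * q + lam ^+ 2 / 2 * (q * (1 - q)) + 3 * `|lam| ^+ 3).
Proof.
move=> /andP[q0 q1] lam2; have l0 : 0 <= `|lam| by [].
set L : R := `|lam| in lam2 l0 *.
pose z := q * expR (lam * (1 - q)) + (1 - q) * expR (- (lam * q)) - 1.
have -> : q * expR lam + (1 - q) = expR (lam * q) * (1 + z).
  have e1 : expR (lam * q) * expR (lam * (1 - q)) = expR lam.
    by rewrite -expRD; congr expR; ring.
  have e2 : expR (lam * q) * expR (- (lam * q)) = 1 by rewrite -expRD subrr expR0.
  by rewrite -[1 - q in LHS]mulr1 -[X in _ + _ * X]e2 -e1 /z; ring.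
have a1 : `|lam * (1 - q)| <= L by rewrite normrM ler_piMr// ger0_norm; lra.
have a2 : `|- (lam * q)| <= L by rewrite normrN normrM ler_piMr// ger0_norm; lra.
have L3 : 0 <= L ^+ 3 by rewrite exprn_ge0.
(* Jensen's inequality: the centred variable has mean 0. *)
have z0 : 0 <= z.
  have := expR_ge1Dx (lam * (1 - q)); have := expR_ge1Dx (- (lam * q)).
  by rewrite /z; nra.
have cube (t : R) : `|t| <= L -> `|expR t - (1 + t + t ^+ 2 / 2)| <= 2 * L ^+ 3.
  move=> tL; apply: (le_trans (expR_taylor2 _ _)); first exact: le_trans lam2.
  by rewrite ler_wpM2l// lerXn2r ?nnegrE.
have zE : `|z - lam ^+ 2 / 2 * (q * (1 - q))| <= 2 * L ^+ 3.
  have := cube _ a1; have := cube _ a2; rewrite !ler_norml /z.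
  set e1 := expR _; set e2 := expR _ => /andP[b1 b2] /andP[b3 b4].
  have q1' : 0 <= 1 - q by lra.
  have c1 := ler_wpM2l q1' b1; have c2 := ler_wpM2l q1' b2.
  have c3 := ler_wpM2l q0 b3; have c4 := ler_wpM2l q0 b4.
  by apply/andP; split; nra.
move: zE; rewrite ler_norml => /andP[zl zu].
apply/andP; split; last first.
  rewrite -addrA expRD ler_pM2l ?expR_gt0//; apply: le_trans (expR_ge1Dx _) _.
  by rewrite ler_expR; lra.
rewrite -addrA expRD ler_pM2l ?expR_gt0//.
have -> : 1 + z = (1 - z / (1 + z))^-1 by field; apply/andP; split; apply: lt0r_neq0; lra.
have z1 : z / (1 + z) < 1 by rewrite ltr_pdivrMr; lra.
apply: (@le_trans _ _ (expR (z / (1 + z)))); last exact: expR_le_inv.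
rewrite ler_expR.
have zz : z - z ^+ 2 <= z / (1 + z).
  rewrite ler_pdivlMr; last lra.
  have -> : (z - z ^+ 2) * (1 + z) = z - z ^+ 3 by ring.
  by rewrite gerBl exprn_ge0.
apply: le_trans zz.
clearbody z.
have lamL : lam ^+ 2 = L ^+ 2 by rewrite -[L ^+ 2]real_normK ?num_real// normr_id real_normK ?num_real.
(* [q * (1 - q)] is at most 1/4 and [L] at most 1/2, whence 1/8 + 1 = 9/8. *)
have zL : z <= L ^+ 2 * (9 / 8).
  have qq : q * (1 - q) <= 1 / 4 by have := sqr_ge0 (q - 1/2); nra.
  have : L ^+ 2 * (q * (1 - q)) <= L ^+ 2 * (1 / 4) by rewrite ler_wpM2l ?sqr_ge0.
  have : L ^+ 3 <= L ^+ 2 * (1/2) by rewrite exprSr ler_wpM2l ?sqr_ge0//; lra.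
  by move: zu; rewrite lamL; lra.
have : z ^+ 2 <= L ^+ 3.
  apply: (@le_trans _ _ ((L ^+ 2 * (9 / 8)) ^+ 2)).
    by rewrite lerXn2r ?nnegrE// mulr_ge0 ?sqr_ge0.
  have : L ^+ 3 * L <= L ^+ 3 * (1/2) by rewrite ler_wpM2l//; lra.
  by nra.
by lra.
Qed.

End ExpBounds.

(** * Negative correlation under a product law *)

Definition upd {I : finType} (x : {ffun I -> bool}) (i : I) (b : bool) :
  {ffun I -> bool} := [ffun k => if k == i then b else x k].

(** The discrete derivative of [F] along coordinate [i]. *)
Definition pivot {R : realType} {I : finType} (F : {ffun I -> bool} -> R)
  (i : I) (x : {ffun I -> bool}) : R := F (upd x i true) - F (upd x i false).

(** Conditional expectation given the coordinates other than [i], kept as a function of the whole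
    outcome so that it can be iterated. *)
Definition integ {R : realType} {I : finType} (p : I -> R) (i : I)
    (F : {ffun I -> bool} -> R) (x : {ffun I -> bool}) : R :=
  p i * F (upd x i true) + (1 - p i) * F (upd x i false).

Section Update.
Context {I : finType}.
Implicit Types (x : {ffun I -> bool}) (i j : I) (b c : bool).

Lemma updK x i b c : upd (upd x i b) i c = upd x i c.
Proof. by apply/ffunP => k; rewrite !ffunE; case: eqP. Qed.

Lemma updC x i j b c : i != j -> upd (upd x i b) j c = upd (upd x j c) i b.
Proof.
move=> ij; apply/ffunP => k; rewrite !ffunE; case: eqP => // ->.
by rewrite eq_sym (negbTE ij).
Qed.

Lemma upd_id x i b : (upd x i b == x) = (x i == b).
Proof.
apply/eqP/eqP => [<-|<-]; first by rewrite ffunE eqxx.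
by apply/ffunP => k; rewrite ffunE; case: eqP => // ->.
Qed.

End Update.

Section NegativeCorrelation.
Context {R : realType} {I : finType} (p : I -> R).
Hypothesis p01 : forall i, 0 <= p i <= 1.
Implicit Types (F G : {ffun I -> bool} -> R).

(** Tower property: outcomes are paired by flipping coordinate [i]; the two members of a pair have
    total weight [rest], and [integ] takes the same value at both. *)
Lemma bmean_integ i F : bmean p (integ p i F) = bmean p F.
Proof.
pose rest x := \prod_(k | k != i) (if (x : {ffun I -> bool}) k then p k else 1 - p k).
have split_i H : bmean p H = \sum_(x : {ffun I -> bool} | x i) rest x * integ p i H x.
  rewrite /bmean (bigID (fun x : {ffun I -> bool} => x i))/=.
  rewrite [X in _ + X](reindex_onto (fun x => upd x i false) (fun x => upd x i true))/=.
    rewrite [X in _ + X](eq_bigl (fun x : {ffun I -> bool} => x i)); last first.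
      by move=> x; rewrite ffunE eqxx updK upd_id eqb_id.
    rewrite -big_split /=; apply: eq_bigr => x xi.
    rewrite /bweight (bigD1 i)//= xi [in X in _ + X](bigD1 i)//= ffunE eqxx.
    have -> : \prod_(k | k != i) (if upd x i false k then p k else 1 - p k) = rest x.
      by apply: eq_bigr => k ki; rewrite ffunE (negbTE ki).
    rewrite -/(rest x) /integ; have /eqP -> : upd x i true == x by rewrite upd_id xi.
    ring.
  by move=> x /negbTE xi; rewrite updK; apply/eqP; rewrite upd_id xi.
rewrite !split_i; apply: eq_bigr => x xi.
rewrite [in LHS]/integ /integ !updK; ring.
Qed.

Definition integs (l : seq I) F := foldr (integ p) F l.

Lemma bmean_integs l F : bmean p (integs l F) = bmean p F.
Proof. by elim: l => //= i l IH; rewrite bmean_integ. Qed.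

Lemma integs_local l F (x y : {ffun I -> bool}) : (forall k, k \notin l -> x k = y k) ->
  integs l F x = integs l F y.
Proof.
elim: l x y => [|i l IH] x y xy /=; first by congr F; apply/ffunP => k; exact: xy.
have xyb b : integs l F (upd x i b) = integs l F (upd y i b).
  apply: IH => k kl; rewrite !ffunE; case: eqP => // /eqP ki.
  by apply: xy; rewrite inE negb_or ki.
by rewrite /integ !xyb.
Qed.

(** Once every coordinate is integrated out, the value no longer depends on the outcome, and each
    integration preserves the mean. A pointwise inequality about [integs] thus becomes one about
    means. *)
Lemma integs_all F x : integs (enum I) F x = bmean p F.
Proof.
rewrite -(bmean_integs (enum I)) -[LHS](bmean_cst p); apply: eq_bigr => y _.
by congr (_ * _); apply: (integs_local _ _ _ _ _) => k; rewrite mem_enum.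
Qed.

(* No coordinate pushes [F] and [G] in the same direction. *)
Definition anticoordinate F G := forall i x y, pivot F i x * pivot G i y <= 0.

Lemma anticoordinate_sym F G : anticoordinate F G -> anticoordinate G F.
Proof. by move=> FG i x y; rewrite mulrC. Qed.

(** The pivot of an integral is an average of pivots taken at other outcomes, and it vanishes along
    the integrated coordinate. The sign survives because [anticoordinate] compares pivots at two
    unrelated outcomes. *)
Lemma anticoordinate_integ j F G :
  anticoordinate F G -> anticoordinate (integ p j F) G.
Proof.
move=> FG i x y; have [ij|ij] := eqVneq i j.
  by rewrite /pivot /integ ij !updK subrr mul0r.
have -> : pivot (integ p j F) i x =
    p j * pivot F i (upd x j true) + (1 - p j) * pivot F i (upd x j false).
  by rewrite /pivot /integ !(updC x _ _ _ _ ij); ring.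
have /andP[p0 p1] := p01 j.
have p1' : 0 <= 1 - p j by lra.
rewrite mulrDl -!mulrA.
have := mulr_ge0_le0 p0 (FG i (upd x j true) y).
have := mulr_ge0_le0 p1' (FG i (upd x j false) y).
lra.
Qed.

Lemma anticoordinate_integs l F G :
  anticoordinate F G -> anticoordinate (integs l F) (integs l G).
Proof.
move=> FG; elim: l => //= i l IH; apply: anticoordinate_integ.
by apply: anticoordinate_sym; apply: anticoordinate_integ; apply: anticoordinate_sym.
Qed.

(** For a two-point law the covariance is [p i * (1 - p i)] times the product of the pivots. *)
Lemma integ_mul i F G x : anticoordinate F G ->
  integ p i (fun x => F x * G x) x <= integ p i F x * integ p i G x.
Proof.
move=> FG; have := FG i x x; rewrite /pivot /integ.
have /andP[p0 p1] := p01 i.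
set a := F _; set b := F _; set c := G _; set e := G _ => h.
rewrite -subr_ge0.
have -> : (p i * a + (1 - p i) * b) * (p i * c + (1 - p i) * e) -
   (p i * (a * c) + (1 - p i) * (b * e)) = p i * (1 - p i) * - ((a - b) * (c - e)) by ring.
by rewrite !mulr_ge0 ?oppr_ge0// subr_ge0.
Qed.

Lemma integs_mul l F G x : anticoordinate F G ->
  integs l (fun x => F x * G x) x <= integs l F x * integs l G x.
Proof.
move=> FG; elim: l x => //= i l IH x.
apply: le_trans (integ_mul _ _ _ _ (anticoordinate_integs l _ _ FG)).
have /andP[p0 p1] := p01 i.
by rewrite /integ lerD// ler_wpM2l// ?subr_ge0.
Qed.

(** The Harris inequality with reversed sign, obtained by integrating out one coordinate at a
    time. *)
Lemma anticoordinate_bmean F G : anticoordinate F G ->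
  bmean p (fun x => F x * G x) <= bmean p F * bmean p G.
Proof.
by move=> FG; rewrite -!(integs_all _ [ffun=> true]); exact: integs_mul.
Qed.

(** Chebyshev's inequality for the number [Z] of events that occur: with nonpositive covariances the
    variance of [Z] is at most its mean [mu], and the bound is [mu / mu ^+ 2]. *)
Lemma second_moment (J : finType) (A : pred J) (B : J -> {ffun I -> bool} -> bool) :
  {in A &, forall j k, j != k ->
     anticoordinate (fun x => (B j x)%:R) (fun x => (B k x)%:R)} ->
  let mu := \sum_(j in A) bmean p (fun x => (B j x)%:R) in
  0 < mu ->
  bmean p (fun x => [forall j in A, ~~ B j x]%:R) <= mu^-1.
Proof.
move=> AB mu mu0.
pose Z x : R := \sum_(j in A) (B j x)%:R.
have EZ : bmean p Z = mu by rewrite /Z bmean_sum.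
have EZ2 : bmean p (fun x => Z x ^+ 2) <= mu + mu ^+ 2.
  rewrite (eq_bmean _ _ (fun x => \sum_(j in A) \sum_(k in A) (B j x)%:R * (B k x)%:R)); last first.
    by move=> x; rewrite expr2 mulr_suml; apply: eq_bigr => j _; rewrite mulr_sumr.
  rewrite bmean_sum expr2 [X in _ + X]mulr_suml -big_split/=; apply: ler_sum => j jA.
  rewrite bmean_sum mulr_sumr (bigD1 j)//= [X in _ <= _ + X](bigD1 j)//=.
  rewrite addrA lerD//; last first.
    apply: ler_sum => k /andP[kA kj]; apply: anticoordinate_bmean.
    by apply: AB => //; rewrite eq_sym.
  rewrite (eq_bmean _ _ (fun x => (B j x)%:R)); last by move=> x; case: (B j x); rewrite ?mulr1 ?mulr0.
  by rewrite lerDl -expr2 sqr_ge0.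
(* The function is [(Z - mu) ^+ 2 / mu ^+ 2], equal to 1 where [Z] vanishes, expanded so that its
   mean is linear in the first two moments. *)
apply: (@le_trans _ _ (bmean p (fun x => (mu ^+ 2)^-1 * (Z x ^+ 2 + ((- 2 * mu) * Z x + mu ^+ 2))))).
  apply: bmean_le => // x; rewrite mulrC ler_pdivlMr ?exprn_gt0//.
  have [/forall_inP noB|_] := boolP [forall j in A, ~~ B j x].
    have -> : Z x = 0 by rewrite /Z big1// => j /noB /negbTE ->.
    by rewrite mul1r; lra.
  rewrite mul0r; have := sqr_ge0 (Z x - mu); nra.
rewrite bmeanZ bmeanD bmeanD bmeanZ bmean_cst EZ mulrC ler_pdivrMr ?exprn_gt0//.
have -> : mu^-1 * mu ^+ 2 = mu by field; exact: lt0r_neq0.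
by move: EZ2; lra.
Qed.

End NegativeCorrelation.

(** * Sharp tails of sums of independent indicators *)

Section IndependentSums.
Context {R : realType} {I : finType} (p : I -> R).
Hypothesis p01 : forall i, 0 <= p i <= 1.

(* Sub-Gaussian bounds that are sharp to second order: [m] and [s2] are the
   mean and variance of [S], and [C] controls the cubic error. *)
Definition sharp_mgf (S : {ffun I -> bool} -> R) (m s2 C : R) :=
  forall lam : R, `|lam| <= 2^-1 ->
  expR (lam * m + lam ^+ 2 / 2 * s2 - C * `|lam| ^+ 3)
    <= bmean p (fun x => expR (lam * S x))
    <= expR (lam * m + lam ^+ 2 / 2 * s2 + C * `|lam| ^+ 3).

(** [o j] is the value of coordinate [e j] that counts: a match is stored once, from the viewpoint
    of the smaller index, so the other player scores on [false]. The cubic errors of the summands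
    add up to at most [3 * N], uniformly in the player. *)
Lemma sharp_mgf_sum (J : finType) (Q : pred J) (e : J -> I) (o : J -> bool) (N : nat) :
  {in Q &, injective e} -> (#|Q| <= N)%N ->
  let q j := if o j then p (e j) else 1 - p (e j) in
  sharp_mgf (fun x => (\sum_(j | Q j) (x (e j) == o j))%N%:R)
    (\sum_(j | Q j) q j) (\sum_(j | Q j) q j * (1 - q j)) (3 * N%:R).
Proof.
move=> einj QN q lam lam2.
have mgfE : bmean p (fun x => expR (lam * (\sum_(j | Q j) (x (e j) == o j))%N%:R)) =
    \prod_(j | Q j) (q j * expR lam + (1 - q j)).
  rewrite (eq_bmean _ _ (fun x => \prod_(j | Q j) expR (lam * (x (e j) == o j)%:R))); last first.
    by move=> x; rewrite natr_sum mulr_sumr expR_sum.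
  rewrite (bmean_prod p _ Q e (fun j b => expR (lam * (b == o j)%:R)))//.
  apply: eq_bigr => j _; rewrite /q.
  by case: (o j); rewrite /= ?mulr1 ?mulr0 expR0 mulr1; lra.
have q01 j : 0 <= q j <= 1 by rewrite /q; have := p01 (e j); case: (o j) => //; lra.
have cub : \sum_(j | Q j) 3 * `|lam| ^+ 3 <= 3 * N%:R * `|lam| ^+ 3.
  rewrite sumr_const -[leLHS]mulr_natr mulrAC ler_wpM2r ?exprn_ge0// ler_wpM2l//.
  by rewrite ler_nat.
have expE c : expR (lam * (\sum_(j | Q j) q j) +
    lam ^+ 2 / 2 * (\sum_(j | Q j) q j * (1 - q j)) + c * \sum_(j | Q j) 3 * `|lam| ^+ 3) =
    \prod_(j | Q j) expR (lam * q j + lam ^+ 2 / 2 * (q j * (1 - q j)) + c * (3 * `|lam| ^+ 3)).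
  by rewrite -expR_sum !mulr_sumr -!big_split.
rewrite mgfE; apply/andP; split.
  apply: (@le_trans _ _ (expR (lam * (\sum_(j | Q j) q j) +
    lam ^+ 2 / 2 * (\sum_(j | Q j) q j * (1 - q j)) + (-1) * \sum_(j | Q j) 3 * `|lam| ^+ 3))).
    by rewrite ler_expR mulN1r lerD2l lerN2.
  rewrite expE; apply: ler_prod => j _; rewrite expR_ge0 mulN1r.
  by have /andP[] := bernoulli_mgf (q j) lam (q01 j) lam2.
apply: (@le_trans _ _ (expR (lam * (\sum_(j | Q j) q j) +
    lam ^+ 2 / 2 * (\sum_(j | Q j) q j * (1 - q j)) + 1 * \sum_(j | Q j) 3 * `|lam| ^+ 3))); last first.
  by rewrite ler_expR mul1r lerD2l.
rewrite expE; apply: ler_prod => j _; rewrite mul1r.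
have /andP[_ ->] := bernoulli_mgf (q j) lam (q01 j) lam2.
by rewrite andbT; have := q01 j; have := expR_ge0 lam; nra.
Qed.

Lemma chernoff_ge S m s2 C (t lam : R) : sharp_mgf S m s2 C -> 0 <= lam <= 2^-1 ->
  bmean p (fun x => (t <= S x)%R%:R) <=
  expR (lam * (m - t) + lam ^+ 2 / 2 * s2 + C * lam ^+ 3).
Proof.
move=> HS /andP[lam0 lam2]; apply: le_trans (bmean_markov p p01 S t lam lam0) _.
have /HS/andP[_ h] : `|lam| <= 2^-1 by rewrite ger0_norm.
apply: le_trans (ler_wpM2l (expR_ge0 _) h) _.
by rewrite -expRD ler_expR ger0_norm//; lra.
Qed.

Lemma chernoff_le S m s2 C (t lam : R) : sharp_mgf S m s2 C -> 0 <= lam <= 2^-1 ->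
  bmean p (fun x => (S x <= t)%R%:R) <=
  expR (lam * (t - m) + lam ^+ 2 / 2 * s2 + C * lam ^+ 3).
Proof.
move=> HS /andP[lam0 lam2]; apply: le_trans (bmean_markov_le p p01 S t lam lam0) _.
have /HS/andP[_ h] : `|- lam| <= 2^-1 by rewrite normrN ger0_norm.
apply: le_trans (ler_wpM2l (expR_ge0 _) h) _.
by rewrite -expRD ler_expR normrN sqrrN ger0_norm//; lra.
Qed.

(* Replaces Cramer's change of measure: the mass that [expR (lam * S)] puts
   outside the window [t, t2] is controlled by the moment generating function at
   [lam - h] and [lam + h]. *)
Lemma tail_lower_bound S m s2 C (t t2 lam h : R) : sharp_mgf S m s2 C ->
  0 <= C -> 0 <= h -> h <= lam -> lam + h <= 2^-1 -> t <= t2 ->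
  h * (t - m) + ((lam - h) ^+ 2 - lam ^+ 2) / 2 * s2 + 2 * C * (lam + h) ^+ 3 <= - 2 ->
  h * (m - t2) + ((lam + h) ^+ 2 - lam ^+ 2) / 2 * s2 + 2 * C * (lam + h) ^+ 3 <= - 2 ->
  2^-1 * expR (lam * (m - t2) + lam ^+ 2 / 2 * s2 - C * lam ^+ 3) <=
  bmean p (fun x => (t <= S x)%R%:R).
Proof.
move=> HS C0 h0 hl lh tt2 H1 H2.
pose M l := bmean p (fun x => expR (l * S x)).
have lam0 : 0 <= lam by lra.
have /HS/andP[Ml _] : `|lam| <= 2^-1 by rewrite ger0_norm; lra.
have /HS/andP[_ Mm] : `|lam - h| <= 2^-1 by rewrite ger0_norm; lra.
have /HS/andP[_ Mp] : `|lam + h| <= 2^-1 by rewrite ger0_norm; lra.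
rewrite -!/(M _) !ger0_norm in Ml Mm Mp; try lra.
(* The factor 2 in [2 * C * (lam + h) ^+ 3] pays for two cubic errors: the one at [lam - h] or
   [lam + h], and the one inside [A]. *)
have cubm : C * (lam - h) ^+ 3 <= C * (lam + h) ^+ 3.
  by rewrite ler_wpM2l// lerXn2r ?nnegrE; lra.
have cubl : C * lam ^+ 3 <= C * (lam + h) ^+ 3.
  by rewrite ler_wpM2l// lerXn2r ?nnegrE; lra.
set A := expR (lam * m + lam ^+ 2 / 2 * s2 - C * lam ^+ 3) in Ml.
(* Each side of the window carries at most a quarter of [A], so half of [A] stays inside. This is
   the origin of [- 2] in the hypotheses and of [2^-1] in the conclusion. *)
have quarter : expR (- 2) <= 4^-1 :> R.
  rewrite expRN lef_pV2 ?posrE ?expR_gt0//.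
  have -> : 2 = 1 + 1 :> R by [].
  by rewrite expRD; have := @expR_ge1Dx R 1; nra.
have A1 : expR (h * t) * M (lam - h) <= 4^-1 * A.
  apply: le_trans (ler_wpM2l (expR_ge0 _) Mm) _; rewrite -expRD.
  apply: (@le_trans _ _ (expR (- 2) * A)); last by rewrite ler_wpM2r ?expR_ge0.
  by rewrite -expRD ler_expR; nra.
have A2 : expR (- (h * t2)) * M (lam + h) <= 4^-1 * A.
  apply: le_trans (ler_wpM2l (expR_ge0 _) Mp) _; rewrite -expRD.
  apply: (@le_trans _ _ (expR (- 2) * A)); last by rewrite ler_wpM2r ?expR_ge0.
  by rewrite -expRD ler_expR; nra.
(* Pointwise, the tilt [lam] is dominated by [lam - h] below [t] and by [lam + h] above [t2]; inside
   the window, [expR (lam * S x)] is at most its value at [t2]. *)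
have key : M lam <= expR (h * t) * M (lam - h) +
    (expR (lam * t2) * bmean p (fun x => (t <= S x)%R%:R) + expR (- (h * t2)) * M (lam + h)).
  rewrite -!bmeanZ -!bmeanD; apply: bmean_le => // x; rewrite -!expRD.
  have e0 (u : R) := expR_ge0 u.
  have [tS|St] /= := lerP t (S x); last first.
    rewrite mulr0 add0r -[leLHS]addr0 lerD// ler_expR.
    by have := ler_wpM2l h0 (ltW St); lra.
  rewrite mulr1; have [St2|t2S] := lerP (S x) t2.
    have : expR (lam * S x) <= expR (lam * t2) by rewrite ler_expR ler_wpM2l.
    have := e0 (h * t + (lam - h) * S x); have := e0 (- (h * t2) + (lam + h) * S x); lra.
  have : expR (lam * S x) <= expR (- (h * t2) + (lam + h) * S x).
    by rewrite ler_expR; have := ler_wpM2l h0 (ltW t2S); lra.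
  have := e0 (h * t + (lam - h) * S x); have := e0 (lam * t2); lra.
have low : 2^-1 * A <= expR (lam * t2) * bmean p (fun x => (t <= S x)%R%:R) by lra.
have -> : lam * (m - t2) + lam ^+ 2 / 2 * s2 - C * lam ^+ 3 =
   - (lam * t2) + (lam * m + lam ^+ 2 / 2 * s2 - C * lam ^+ 3) by lra.
rewrite expRD -/A mulrCA expRN mulrC ler_pdivrMr ?expR_gt0//.
by rewrite [leRHS]mulrC.
Qed.

End IndependentSums.

(** * Tournaments with fixed strengths *)

Section Tournament.
Context {R : realType} {N : nat} (s : 'I_N.+1 -> R).
Hypothesis s_gt0 : forall i, 0 < s i.
Implicit Types (x : outcome N) (i j k : 'I_N.+1).

(** A pair that is not increasing stores no match; success probability 0 forces its entry to
    [false], so that [tweight] is a Bernoulli product over all pairs. *)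
Definition matchp (c : 'I_N.+1 * 'I_N.+1) : R :=
  if (c.1 < c.2)%N then s c.1 / (s c.1 + s c.2) else 0.

Definition match_of i j := if (i < j)%N then (i, j) else (j, i).

(** Player N+1 is nobody's opponent, as the scores S_i omit the match against him: there are N - 1
    opponents for [i < N] and N for [ord_max]. *)
Definition opponents i : pred 'I_N.+1 := fun j => (j < N)%N && (j != i).

Definition score_mean i := \sum_(j | opponents i j) s i / (s i + s j).

Definition score_var i :=
  \sum_(j | opponents i j) s i / (s i + s j) * (1 - s i / (s i + s j)).

Lemma matchp01 c : 0 <= matchp c <= 1.
Proof.
rewrite /matchp; case: ifP => _; last by rewrite lexx ler01.
have := s_gt0 c.1; have := s_gt0 c.2 => h1 h2.
by rewrite divr_ge0 ?ler_pdivrMr; lra.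
Qed.

Lemma winprob_compl i j : 1 - s i / (s i + s j) = s j / (s j + s i).
Proof. by have := s_gt0 i; have := s_gt0 j; move=> h1 h2; field; do ?[apply/andP; split]; apply: lt0r_neq0; lra. Qed.

Lemma tweightE x : tweight s x = bweight matchp x.
Proof.
apply: eq_bigr => c _; rewrite /matchp; case: ifP => _; case: (x c) => //.
  by rewrite winprob_compl addrC.
by rewrite subr0.
Qed.

Lemma qprobE (E : pred (outcome N)) : qprob s E = bmean matchp (fun x => (E x)%:R).
Proof.
rewrite /qprob /bmean big_mkcond; apply: eq_bigr => x _; rewrite tweightE.
by case: (E x); rewrite ?mulr1 ?mulr0.
Qed.

Lemma scoreE x i :
  score x i = (\sum_(j | opponents i j) (x (match_of i j) == (i < j)))%N.
Proof.
apply: eq_bigr => j /andP[_ ji]; rewrite /beats /match_of.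
case: ltngtP ji => [ij|ij|/ord_inj->] ji; last by rewrite eqxx in ji.
  by case: (x _).
by case: (x _).
Qed.

Lemma match_of_inj i : {in opponents i &, injective (match_of i)}.
Proof.
move=> j k; rewrite !unfold_in /match_of => /andP[_ ji] /andP[_ ki].
by case: ltnP => ij; case: ltnP => ik [] // *; subst; rewrite ?eqxx in ji ki.
Qed.

Lemma card_opponents i : (#|opponents i| <= N)%N.
Proof.
apply: (@leq_trans #|predC1 (ord_max : 'I_N.+1)|).
  apply: subset_leq_card; apply/fintype.subsetP => j /andP[jN _]; rewrite !inE.
  by apply/eqP => jE; rewrite jE ltnn in jN.
by rewrite cardC1 card_ord.
Qed.

Lemma score_sharp_mgf i :
  sharp_mgf matchp (fun x => (score x i)%:R) (score_mean i) (score_var i) (3 * N%:R).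
Proof.
have := sharp_mgf_sum _ matchp01 _ (opponents i) (match_of i) (fun j => (i < j)%N) N
  (match_of_inj i) (card_opponents i).
have qE j : opponents i j -> (if (i < j)%N then matchp (match_of i j)
    else 1 - matchp (match_of i j)) = s i / (s i + s j).
  move=> /andP[_ ji]; rewrite /matchp /match_of.
  case: (ltngtP i j) ji => [ij|ij|/ord_inj->] ji; last by rewrite eqxx in ji.
    by rewrite /= ij.
  by rewrite /= ij winprob_compl.
pose q j := if (i < j)%N then matchp (match_of i j) else 1 - matchp (match_of i j).
have e1 : \sum_(j | opponents i j) q j = score_mean i by apply: eq_bigr => j /qE.
have e2 : \sum_(j | opponents i j) q j * (1 - q j) = score_var i.
  by apply: eq_bigr => j /qE; rewrite /q => ->.
rewrite /= -/q e1 e2.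
move=> h lam /h; rewrite (eq_bmean _ _ (fun x => expR (lam * (score x i)%:R)))//.
by move=> x; rewrite scoreE.
Qed.

(** The hypothesis excludes only entries with [i] in second position. It also admits those in which
    [i] does not occur; together with [score_upd_decr] this gives them a zero pivot. *)
Lemma score_upd_incr x c i : c.2 != i ->
  (score (upd x c false) i <= score (upd x c true) i)%N.
Proof.
move=> ci; rewrite !scoreE; apply: leq_sum => j _; rewrite !ffunE.
have [E|//] := eqVneq (match_of i j) c; move: ci; rewrite -E /match_of.
by case: ltnP => //=; rewrite eqxx.
Qed.

Lemma score_upd_decr x c i : c.1 != i ->
  (score (upd x c true) i <= score (upd x c false) i)%N.
Proof.
move=> ci; rewrite !scoreE; apply: leq_sum => j _; rewrite !ffunE.
have [E|//] := eqVneq (match_of i j) c; move: ci; rewrite -E /match_of.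
by case: ltnP => //=; rewrite eqxx.
Qed.

Lemma ler_indicator_nat (t : R) (a b : nat) : (a <= b)%N ->
  (t <= a%:R)%R%:R <= (t <= b%:R)%R%:R :> R.
Proof.
move=> ab; rewrite ler_nat; case: (boolP (t <= a%:R)) => // h.
by rewrite (le_trans h) // ler_nat.
Qed.

Lemma score_anticoordinate (t : R) i k : i != k ->
  anticoordinate (fun x => (t <= (score x i)%:R)%R%:R : R)
                 (fun x => (t <= (score x k)%:R)%R%:R : R).
Proof.
move=> ik c x y.
have incr z j : c.2 != j -> 0 <= pivot (fun x => (t <= (score x j)%:R)%R%:R : R) c z.
  by move=> cj; rewrite /pivot subr_ge0; apply: ler_indicator_nat; exact: score_upd_incr.
have decr z j : c.1 != j -> pivot (fun x => (t <= (score x j)%:R)%R%:R : R) c z <= 0.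
  by move=> cj; rewrite /pivot subr_le0; apply: ler_indicator_nat; exact: score_upd_decr.
have zero z j : c.1 != j -> c.2 != j -> pivot (fun x => (t <= (score x j)%:R)%R%:R : R) c z = 0.
  by move=> c1 c2; apply/eqP; rewrite eq_le decr// incr.
have [c2i|c2i] := eqVneq c.2 i.
  have c2k : c.2 != k by rewrite c2i.
  have [c1i|c1i] := eqVneq c.1 i; first by rewrite (zero y k) ?mulr0// c1i.
  by rewrite mulr_le0_ge0 ?decr ?incr.
have [c1k|c1k] := eqVneq c.1 k; last by rewrite mulr_ge0_le0 ?decr ?incr.
by rewrite (zero x i) ?mul0r// c1k eq_sym.
Qed.

End Tournament.

(** * Mean and variance of a score as functions of the strength *)

Section MeanScores.
Context {R : realType} {N : nat} (s : 'I_N.+1 -> R).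
Hypothesis s_gt0 : forall i, 0 < s i.
Hypothesis s_le1 : forall i : 'I_N.+1, (i < N)%N -> s i <= 1.

Definition strength_score (v : R) : R := \sum_(j < N.+1 | (j < N)%N) v / (v + s j).

(* Up to the factor [v - 1], the increment of [strength_score] from [1] to [v];
   also the variance of the score of a player of strength near [1]. *)
Definition strength_info : R := \sum_(j < N.+1 | (j < N)%N) s j / (s j + 1) ^+ 2.

Local Notation f := strength_score.
Local Notation D := strength_info.

Lemma strength_info_ge0 : 0 <= D.
Proof. by apply: sumr_ge0 => j _; rewrite divr_ge0 ?sqr_ge0 ?ltW. Qed.

Lemma strength_score_le v v' : 0 < v -> v <= v' -> f v <= f v'.
Proof.
move=> v0 vv'; apply: ler_sum => j _; have sj := s_gt0 j.
have v'0 : 0 < v' by lra.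
rewrite ler_pdivrMr ?addr_gt0// mulrAC ler_pdivlMr ?addr_gt0//.
by rewrite !mulrDr [v' * v]mulrC lerD2l ler_wpM2r// ltW.
Qed.

(** The middle term is the exact difference quotient of [v / (v + t)] between 1 and [v], compared
    with the derivative at 1. The factor [v^-1] is harmless for [v] within O(r) of 1. *)
Lemma pair_info_ge1 (v t : R) : 1 <= v -> 0 < t ->
  v^-1 * (t / (t + 1) ^+ 2) <= t / ((v + t) * (t + 1)) <= t / (t + 1) ^+ 2.
Proof.
move=> v1 t0; have t1 : 0 < t + 1 by lra.
have vt : 0 < v + t by lra.
have v0 : 0 < v by lra.
rewrite expr2 [v^-1 * _]mulrCA -invfM !ler_pM2l ?invr_gt0 ?mulr_gt0//.
rewrite !lef_pV2 ?posrE ?mulr_gt0// mulrA !ler_pM2r//.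
by apply/andP; split; [nra|lra].
Qed.

Lemma pair_info_le1 (v t : R) : 0 < v -> v <= 1 -> 0 < t ->
  t / (t + 1) ^+ 2 <= t / ((v + t) * (t + 1)) <= v^-1 * (t / (t + 1) ^+ 2).
Proof.
move=> v0 v1 t0; have t1 : 0 < t + 1 by lra.
have vt : 0 < v + t by lra.
rewrite expr2 [v^-1 * _]mulrCA -invfM !ler_pM2l ?invr_gt0 ?mulr_gt0//.
rewrite !lef_pV2 ?posrE ?mulr_gt0// mulrA !ler_pM2r//.
by apply/andP; split; [lra|nra].
Qed.

(** An exact increment, so that no Taylor remainder has to be controlled. *)
Lemma strength_scoreB v : 0 < v ->
  f v = f 1 + (v - 1) * \sum_(j < N.+1 | (j < N)%N) s j / ((v + s j) * (s j + 1)).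
Proof.
move=> v0; rewrite mulr_sumr -big_split/=; apply: eq_bigr => j _.
by have := s_gt0 j => sj; field; do ?[apply/andP; split]; apply: lt0r_neq0; lra.
Qed.

Lemma strength_score_ge1 v : 1 <= v ->
  f 1 + (v - 1) / v * D <= f v <= f 1 + (v - 1) * D.
Proof.
move=> v1; rewrite (strength_scoreB v); last lra.
rewrite !lerD2l -mulrA !ler_wpM2l ?subr_ge0//; last first.
  by rewrite mulr_sumr; apply: ler_sum => j _; have /andP[] := pair_info_ge1 v (s j) v1 (s_gt0 j).
by apply: ler_sum => j _; have /andP[] := pair_info_ge1 v (s j) v1 (s_gt0 j).
Qed.

Lemma strength_score_le1 v : 0 < v -> v <= 1 ->
  f 1 - (1 - v) / v * D <= f v <= f 1 - (1 - v) * D.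
Proof.
move=> v0 v1; rewrite (strength_scoreB v)// -[v - 1]opprB mulNr.
rewrite !lerD2l !lerN2 -mulrA !ler_wpM2l ?subr_ge0//.
  by apply: ler_sum => j _; have /andP[] := pair_info_le1 v (s j) v0 v1 (s_gt0 j).
by rewrite mulr_sumr; apply: ler_sum => j _; have /andP[] := pair_info_le1 v (s j) v0 v1 (s_gt0 j).
Qed.

Lemma sum_opponents (i : 'I_N.+1) (F : 'I_N.+1 -> R) : (i < N)%N ->
  \sum_(j | opponents i j) F j = \sum_(j < N.+1 | (j < N)%N) F j - F i.
Proof. by move=> iN; rewrite [in RHS](bigD1 i iN)/= addrAC subrr add0r. Qed.

(** [strength_score] also counts a fictitious match of player [i] against himself, won with
    probability 1/2. *)
Lemma score_mean_lt (i : 'I_N.+1) : (i < N)%N -> score_mean s i = f (s i) - 2^-1.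
Proof.
move=> iN; rewrite /score_mean (sum_opponents i (fun j => s i / (s i + s j)) iN).
by congr (_ - _); have := s_gt0 i => ?; field; apply: lt0r_neq0; lra.
Qed.

Lemma score_mean_max : score_mean s ord_max = f (s ord_max).
Proof.
apply: eq_bigl => j; rewrite /opponents.
by have [jN|//] := boolP (j < N)%N; apply/eqP => jE; rewrite jE ltnn in jN.
Qed.

Lemma score_var_le i : score_var s i <= N%:R / 4.
Proof.
apply: (@le_trans _ _ (\sum_(j | opponents i j) 4^-1)); last first.
  by rewrite sumr_const -[leLHS]mulr_natl ler_wpM2r// ler_nat card_opponents.
apply: ler_sum => j _; set q := _ / _; have := sqr_ge0 (q - 1/2); nra.
Qed.

(** Termwise comparison of [s i * s j / (s i + s j) ^+ 2] with [s j / (s j + 1) ^+ 2]: from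
    [s i <= 1] follows [s i * (s j + 1) <= s i + s j <= s j + 1]. The [4^-1] is the variance of the
    fictitious match. *)
Lemma score_var_bounds (i : 'I_N.+1) : (i < N)%N ->
  s i * D - 4^-1 <= score_var s i <= D / s i.
Proof.
move=> iN; have si := s_gt0 i; have si1 := s_le1 i iN.
pose F j := s i / (s i + s j) * (1 - s i / (s i + s j)).
have FE j : F j = s i * s j / (s i + s j) ^+ 2.
  by rewrite /F; have := s_gt0 j => ?; field; apply: lt0r_neq0; lra.
have Fi : F i = 4^-1 by rewrite FE; field; apply: lt0r_neq0; lra.
rewrite /score_var (sum_opponents i F iN) Fi; apply/andP; split.
  rewrite lerD2r mulr_sumr; apply: ler_sum => j jN; rewrite FE.
  have sj := s_gt0 j; have h : 0 < s i * s j by rewrite mulr_gt0.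
  rewrite mulrA ler_pM2l// lef_pV2 ?posrE ?exprn_gt0 ?addr_gt0//.
  by rewrite lerXn2r ?nnegrE; lra.
apply: (@le_trans _ _ (\sum_(j < N.+1 | (j < N)%N) F j)); first by rewrite gerBl.
rewrite mulr_suml; apply: ler_sum => j jN; rewrite FE.
have sj := s_gt0 j; have sj1 := s_le1 j jN.
have sj1' : 0 < s j + 1 by lra.
rewrite ler_pdivlMr// ler_pdivlMr ?exprn_gt0//.
have -> : s i * s j / (s i + s j) ^+ 2 * s i * (s j + 1) ^+ 2 =
    s j * ((s i * (s j + 1)) ^+ 2 / (s i + s j) ^+ 2).
  by field; apply: lt0r_neq0; lra.
apply: ler_piMr; first exact: ltW.
rewrite ler_pdivrMr ?exprn_gt0 ?addr_gt0// mul1r.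
have : s i * (s j + 1) <= s i + s j by nra.
have : 0 <= s i * (s j + 1) by rewrite mulr_ge0; lra.
by move=> h0 h1; rewrite lerXn2r ?nnegrE; lra.
Qed.

End MeanScores.

(** * Reduction to tail events of single scores *)

Section UnionBounds.
Context {R : realType} {N : nat} (s : 'I_N.+1 -> R).
Hypothesis s_gt0 : forall i, 0 < s i.

Local Notation E := (bmean (matchp s)).

Lemma qprob_le (A B : pred (outcome N)) :
  (forall x, A x -> B x) -> qprob s A <= qprob s B.
Proof.
move=> AB; rewrite !qprobE//; apply: bmean_le => [|x]; first exact: matchp01.
by have := AB x; case: (A x) => [->|]; rewrite // ler0n.
Qed.

Lemma strong_win_wins x : strong_win x -> wins (N := N) x.
Proof.
move=> h; apply/forallP => i; apply/implyP => iN.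
have h1 : (score x i <= \max_(i < N.+1 | (i < N)%N) score x i)%N.
  exact: (@leq_bigmax_cond _ (fun i : 'I_N.+1 => (i < N)%N) (fun i => score x i) i).
have h2 : (beats x i ord_max <= 1)%N.
  by rewrite /beats; case: ifP => _; [|case: ifP => _]; rewrite ?leq_b1.
move: h; rewrite /strong_win => /ltnW; apply: leq_trans.
by rewrite addnC leq_add.
Qed.

Lemma strong_lose_not_wins x : strong_lose x -> not_wins (N := N) x.
Proof.
rewrite /strong_lose /not_wins => h; apply/negP => /forallP W; move: h.
rewrite ltnNge => /negP; apply; apply/bigmax_leqP => i iN.
have := W i; rewrite iN /=; apply: leq_trans; exact: leq_addr.
Qed.

(** If all other scores stay below [t] and the challenger exceeds [t + 1], the win is strong.
    [0 <= t] accounts for the initial value 0 of the maximum. *)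
Lemma compl_strong_win (t : R) : 0 <= t ->
  1 - qprob s (strong_win (N := N)) <=
  E (fun x => ((score x ord_max)%:R <= t + 1)%R%:R) +
  \sum_(i < N.+1 | (i < N)%N) E (fun x => (t <= (score x i)%:R)%R%:R).
Proof.
move=> t0; rewrite qprobE// -[X in X - _](bmean_cst (matchp s)) -bmean_sum -bmeanD.
rewrite -mulN1r -bmeanZ -bmeanD; apply: bmean_le => [|x]; first exact: matchp01.
have sum0 : 0 <= \sum_(i < N.+1 | (i < N)%N) (t <= (score x i)%:R)%R%:R :> R.
  by apply: sumr_ge0 => i _; rewrite ler0n.
have [_|/negP sw] := boolP (strong_win x).
  by rewrite mulN1r subrr addr_ge0// ler0n.
have [_|tS] := lerP (score x ord_max)%:R (t + 1); first by rewrite mulr0 addr0 lerDl.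
rewrite mulr0 addr0 add0r.
have [i /andP[iN tSi]|no] := pickP (fun i : 'I_N.+1 => (i < N)%N && (t <= (score x i)%:R)).
  by rewrite (bigD1 i)//= tSi lerDl; apply: sumr_ge0 => j _; rewrite ler0n.
case: sw; rewrite /strong_win -(ltr_nat R) natrD; apply: le_lt_trans tS.
rewrite addrC lerD2r; elim/big_ind : _ => // [a b ta tb|i iN].
  by case: (leqP a b).
by have := no i; rewrite iN/= => /negbT; rewrite -ltNge => /ltW.
Qed.

(** Any set [A] of players bounds the maximum from below, so one may keep only players whose tail is
    known from below. *)
Lemma compl_strong_lose (t : R) (A : pred 'I_N.+1) :
  (forall i, A i -> (i < N)%N) ->
  1 - qprob s (strong_lose (N := N)) <=
  E (fun x => (t <= (score x ord_max)%:R)%R%:R) +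
  E (fun x => [forall i in A, ~~ (t <= (score x i)%:R)%R]%:R).
Proof.
move=> AN; rewrite qprobE// -[X in X - _](bmean_cst (matchp s)) -bmeanD.
rewrite -mulN1r -bmeanZ -bmeanD; apply: bmean_le => [|x]; first exact: matchp01.
have [_|/negP sl] := boolP (strong_lose x).
  by rewrite mulN1r subrr addr_ge0// ler0n.
have [_|tS] := lerP t (score x ord_max)%:R; first by rewrite mulr0 addr0 lerDl ler0n.
rewrite mulr0 addr0 add0r.
suff -> : [forall i in A, ~~ (t <= (score x i)%:R)] by [].
apply/forall_inP => i iA; apply/negP => tSi; case: sl; rewrite /strong_lose.
apply: (@leq_trans (score x i)); first by rewrite -(ltr_nat R); exact: lt_le_trans tSi.
by apply: (@leq_bigmax_cond _ (fun i : 'I_N.+1 => (i < N)%N) (fun i => score x i) i); apply: AN.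
Qed.

End UnionBounds.

(** * Explicit bounds at scale [r], with exponents proportional to [l] *)

Section QuantitativeBounds.
Context {R : realType} {N : nat} (s : 'I_N.+1 -> R) (r l d K : R).
Hypothesis s_gt0 : forall i, 0 < s i.
Hypothesis s_le1 : forall i : 'I_N.+1, (i < N)%N -> s i <= 1.
Hypothesis r_gt0 : 0 < r.
Hypothesis lE : l = N%:R * r ^+ 2.
Hypothesis l_ge1 : 1 <= l.
Hypothesis dE : strength_info s = N%:R * d.
Hypothesis K_ge0 : 0 <= K.
Hypothesis Kr_lt1 : K * r < 1.

Definition strong_players : pred 'I_N.+1 := fun i => (i < N)%N && (1 - K * r < s i).

Local Notation E := (bmean (matchp s)).
Local Notation n := (N%:R : R).
Local Notation f := (strength_score s).

(** The [+ 1] of the threshold is the margin in [strong_win]; as [1 <= l], it costs at most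
    [l * (k * r)], whence [b + r] in the exponent. *)
Lemma challenger_le (b c k : R) : 0 <= c -> 0 <= k -> k * r <= 2^-1 ->
  1 + c * r <= s ord_max ->
  E (fun x => ((score x ord_max)%:R <= f 1 + b * n * r + 1)%R%:R) <=
  expR (l * (k * (b + r - c * d / (1 + c * r)) + k ^+ 2 / 8 + 3 * k ^+ 3 * r)).
Proof.
move=> c0 k0 kr cs.
have cr : 0 <= c * r by rewrite mulr_ge0// ltW.
apply: le_trans (chernoff_le (matchp s) (matchp01 s s_gt0) _ _ _ _ _ (k * r)
  (score_sharp_mgf s s_gt0 ord_max) _) _; first by rewrite kr mulr_ge0// ltW.
have v1 : 1 <= 1 + c * r by lra.
have /andP[h1 _] := strength_score_ge1 s s_gt0 _ v1.
have h2 : f (1 + c * r) <= score_mean s ord_max.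
  by rewrite score_mean_max strength_score_le//; lra.
have h3 := score_var_le s ord_max.
rewrite ler_expR.
have -> : l * (k * (b + r - c * d / (1 + c * r)) + k ^+ 2 / 8 + 3 * k ^+ 3 * r) =
  k * r * (f 1 + b * n * r - (f 1 + (1 + c * r - 1) / (1 + c * r) * strength_info s)) +
  k * r * l + (k * r) ^+ 2 / 2 * (n / 4) + 3 * n * (k * r) ^+ 3.
  by rewrite dE lE; field; apply: lt0r_neq0; lra.
rewrite lerD2r; apply: lerD; last by rewrite ler_wpM2l// divr_ge0 ?sqr_ge0.
have kr0 : 0 <= k * r by rewrite mulr_ge0// ltW.
have A := ler_wpM2l kr0 (le_trans h1 h2).
by have B := ler_wpM2l kr0 l_ge1; lra.
Qed.

(** The sharp variance is essential here, since the exponent is weighed against the number of strong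
    players. The mean is at most [f 1] because [s i <= 1]. *)
Lemma strong_player_ge (b k : R) i : strong_players i -> 0 <= k -> k * r <= 2^-1 ->
  0 <= d ->
  E (fun x => (f 1 + b * n * r <= (score x i)%:R)%R%:R) <=
  expR (l * (- k * b + k ^+ 2 * d / (2 * (1 - K * r)) + 3 * k ^+ 3 * r)).
Proof.
move=> /andP[iN Ki] k0 kr d0.
have kr0 : 0 <= k * r by rewrite mulr_ge0// ltW.
apply: le_trans (chernoff_ge (matchp s) (matchp01 s s_gt0) _ _ _ _ _ (k * r)
  (score_sharp_mgf s s_gt0 i) _) _; first by rewrite kr kr0.
have h1 : score_mean s i <= f 1.
  rewrite score_mean_lt// lerBlDr (le_trans (strength_score_le s s_gt0 _ 1 (s_gt0 i) (s_le1 i iN)))//.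
  by rewrite lerDl.
have /andP[_ h2] := score_var_bounds s s_gt0 s_le1 i iN.
have h3 : strength_info s / s i <= n * d / (1 - K * r).
  rewrite -dE; apply: ler_wpM2l; first exact: strength_info_ge0.
  by rewrite lef_pV2 ?posrE ?s_gt0 ?subr_gt0//; exact: ltW.
rewrite ler_expR.
have -> : l * (- k * b + k ^+ 2 * d / (2 * (1 - K * r)) + 3 * k ^+ 3 * r) =
  k * r * (f 1 - (f 1 + b * n * r)) + (k * r) ^+ 2 / 2 * (n * d / (1 - K * r))
   + 3 * n * (k * r) ^+ 3.
  by rewrite lE; field; apply: lt0r_neq0; rewrite subr_gt0.
rewrite lerD2r; apply: lerD; first by rewrite ler_wpM2l//; lra.
by rewrite ler_wpM2l ?divr_ge0 ?sqr_ge0//; exact: le_trans h3.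
Qed.

(** The deficit in strength lowers the mean by at least [K * d * n * r]; for [K] large this
    outweighs the number of players even with the crude variance. *)
Lemma weak_player_ge (b k : R) (i : 'I_N.+1) : (i < N)%N -> s i <= 1 - K * r ->
  0 <= k -> k * r <= 2^-1 ->
  E (fun x => (f 1 + b * n * r <= (score x i)%:R)%R%:R) <=
  expR (l * (- k * (b + K * d) + k ^+ 2 / 8 + 3 * k ^+ 3 * r)).
Proof.
move=> iN Ki k0 kr.
have kr0 : 0 <= k * r by rewrite mulr_ge0// ltW.
apply: le_trans (chernoff_ge (matchp s) (matchp01 s s_gt0) _ _ _ _ _ (k * r)
  (score_sharp_mgf s s_gt0 i) _) _; first by rewrite kr kr0.
have /andP[_ h1] := strength_score_le1 s s_gt0 _ (s_gt0 i) (s_le1 i iN).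
have h2 : K * r * strength_info s <= (1 - s i) * strength_info s.
  by rewrite ler_wpM2r ?strength_info_ge0//; lra.
have h3 := score_mean_lt s s_gt0 i iN.
rewrite ler_expR.
have -> : l * (- k * (b + K * d) + k ^+ 2 / 8 + 3 * k ^+ 3 * r) =
  k * r * (f 1 - K * r * (n * d) - (f 1 + b * n * r)) + (k * r) ^+ 2 / 2 * (n / 4)
   + 3 * n * (k * r) ^+ 3.
  by rewrite lE; field.
rewrite lerD2r -dE; apply: lerD.
  by rewrite ler_wpM2l//; lra.
by rewrite ler_wpM2l ?divr_ge0 ?sqr_ge0// score_var_le.
Qed.

Lemma upper_half (b c k1 k2 k3 : R) : 0 <= b -> 0 <= c -> 0 <= d ->
  0 <= k1 -> k1 * r <= 2^-1 -> 0 <= k2 -> k2 * r <= 2^-1 ->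
  0 <= k3 -> k3 * r <= 2^-1 ->
  1 + c * r <= s ord_max ->
  1 - qprob s (strong_win (N := N)) <=
  expR (l * (k1 * (b + r - c * d / (1 + c * r)) + k1 ^+ 2 / 8 + 3 * k1 ^+ 3 * r)) +
  (#|strong_players|%:R *
   expR (l * (- k2 * b + k2 ^+ 2 * d / (2 * (1 - K * r)) + 3 * k2 ^+ 3 * r)) +
   n * expR (l * (- k3 * (b + K * d) + k3 ^+ 2 / 8 + 3 * k3 ^+ 3 * r))).
Proof.
move=> b0 c0 d0 k10 k1r k20 k2r k30 k3r cs.
have t0 : 0 <= f 1 + b * n * r.
  apply: addr_ge0; last by rewrite !mulr_ge0// ltW.
  by apply: sumr_ge0 => j _; rewrite divr_ge0// addr_ge0// ltW.
apply: le_trans (compl_strong_win s s_gt0 _ t0) _.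
apply: lerD; first exact: challenger_le.
rewrite (bigID (fun i => 1 - K * r < s i))/=; apply: lerD.
  rewrite mulr_natl -sumr_const; apply: ler_sum => i iS; exact: strong_player_ge.
apply: (@le_trans _ _ (\sum_(i < N.+1 | (i < N)%N && ~~ (1 - K * r < s i))
   expR (l * (- k3 * (b + K * d) + k3 ^+ 2 / 8 + 3 * k3 ^+ 3 * r)))).
  by apply: ler_sum => i /andP[iN]; rewrite -leNgt => si; exact: weak_player_ge.
rewrite sumr_const -[leLHS]mulr_natl ler_wpM2r ?expR_ge0// ler_nat.
apply: (@leq_trans #|predC1 (ord_max : 'I_N.+1)|); last by rewrite cardC1 card_ord.
apply: subset_leq_card; apply/fintype.subsetP => j /andP[jN _]; rewrite !inE.
by apply/eqP => jE; rewrite jE ltnn in jN.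
Qed.

Lemma challenger_ge (b c k : R) : 0 <= c -> 0 <= k -> k * r <= 2^-1 ->
  s ord_max <= 1 + c * r ->
  E (fun x => (f 1 + b * n * r <= (score x ord_max)%:R)%R%:R) <=
  expR (l * (k * (c * d - b) + k ^+ 2 / 8 + 3 * k ^+ 3 * r)).
Proof.
move=> c0 k0 kr cs.
have kr0 : 0 <= k * r by rewrite mulr_ge0// ltW.
have cr0 : 0 <= c * r by rewrite mulr_ge0// ltW.
apply: le_trans (chernoff_ge (matchp s) (matchp01 s s_gt0) _ _ _ _ _ (k * r)
  (score_sharp_mgf s s_gt0 ord_max) _) _; first by rewrite kr kr0.
have v1 : 1 <= 1 + c * r by lra.
have /andP[_ h1] := strength_score_ge1 s s_gt0 _ v1.
have h2 : score_mean s ord_max <= f (1 + c * r).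
  by rewrite score_mean_max strength_score_le.
rewrite ler_expR.
have -> : l * (k * (c * d - b) + k ^+ 2 / 8 + 3 * k ^+ 3 * r) =
  k * r * (f 1 + (1 + c * r - 1) * (n * d) - (f 1 + b * n * r)) + (k * r) ^+ 2 / 2 * (n / 4)
   + 3 * n * (k * r) ^+ 3.
  by rewrite lE; field.
rewrite lerD2r -dE; apply: lerD.
  by rewrite ler_wpM2l//; lra.
by rewrite ler_wpM2l ?divr_ge0 ?sqr_ge0// score_var_le.
Qed.

(* [tau * n * r] bounds the excess of the threshold over the mean score of a
   strong player; [y] is the half width of the window of [tail_lower_bound]. *)
Lemma strong_player_lower (b k h tau y : R) i : strong_players i -> 0 <= d ->
  0 <= h -> h <= k -> (k + h) * r <= 2^-1 -> 0 <= y ->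
  b + K * d / (1 - K * r) + r <= tau ->
  let lo := (1 - K * r) * d - r ^+ 2 in
  let hi := d / (1 - K * r) in
  l * (h * tau + (h ^+ 2 - 2 * k * h) / 2 * lo + 6 * (k + h) ^+ 3 * r) <= - 2 ->
  l * (- h * (tau + 2 * y) + (h ^+ 2 + 2 * k * h) / 2 * hi + 6 * (k + h) ^+ 3 * r) <= - 2 ->
  2^-1 * expR (l * (- k * (tau + 2 * y) + k ^+ 2 / 2 * lo - 3 * k ^+ 3 * r)) <=
  E (fun x => (f 1 + b * n * r <= (score x i)%:R)%R%:R).
Proof.
move=> /andP[iN Ki] d0 h0 hk khr y0 tauE lo hi C1 C2.
have D0 := strength_info_ge0 s s_gt0.
have Kr1 : 0 < 1 - K * r by rewrite subr_gt0.
have Kr0 : 0 <= K * r by rewrite mulr_ge0// ltW.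
have si := s_gt0 i; have si1 := s_le1 i iN.
have nr2 : 1 <= n * r ^+ 2 by rewrite -lE.
have nr0 : 0 <= n * r by rewrite mulr_ge0// ltW.
have /andP[v1 v2] := score_var_bounds s s_gt0 s_le1 i iN.
(* The 1/4 of the fictitious match is absorbed by the [r ^+ 2] in [lo], because [n * r ^+ 2 = l] is
   at least 1. *)
have var_lo : n * lo <= score_var s i.
  apply: le_trans v1.
  have : (1 - K * r) * strength_info s <= s i * strength_info s by rewrite ler_wpM2r// ltW.
  rewrite dE /lo; nra.
have var_hi : score_var s i <= n * hi.
  apply: le_trans v2 _; rewrite /hi mulrA -dE ler_wpM2l// lef_pV2 ?posrE//; exact: ltW.
set m := score_mean s i; set s2 := score_var s i in var_lo var_hi *.
(* Likewise the 1/2 in the mean is absorbed by the summand [r] of the lower bound on [tau]. *)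
have tm : f 1 + b * n * r <= m + tau * (n * r).
  have /andP[f1 _] := strength_score_le1 s s_gt0 _ si si1.
  have f2 : (1 - s i) / s i * strength_info s <= K * r / (1 - K * r) * strength_info s.
    rewrite ler_wpM2r// ler_pdivrMr// mulrAC ler_pdivlMr//; nra.
  have f3 : b * (n * r) + K * d / (1 - K * r) * (n * r) + r * (n * r) <= tau * (n * r).
    by rewrite -!mulrDl ler_wpM2r.
  have e1 : K * r / (1 - K * r) * strength_info s = K * d / (1 - K * r) * (n * r).
    by rewrite dE; ring.
  have e2 : r * (n * r) = n * r ^+ 2 by ring.
  rewrite /m score_mean_lt//; lra.
apply: (@le_trans _ _ (E (fun x => (m + tau * (n * r) <= (score x i)%:R)%R%:R))); last first.
  apply: bmean_le => [|x]; first exact: matchp01.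
  by case: (lerP (m + _) _) => [h1|_]; rewrite ?ler0n// (le_trans tm).
apply: le_trans (tail_lower_bound (matchp s) (matchp01 s s_gt0) _ m s2 (3 * n)
  (m + tau * (n * r)) (m + (tau + 2 * y) * (n * r)) (k * r) (h * r)
  (score_sharp_mgf s s_gt0 i) _ _ _ _ _ _ _).
- rewrite ler_pM2l// ler_expR.
  have : (k * r) ^+ 2 / 2 * (n * lo) <= (k * r) ^+ 2 / 2 * s2.
    by rewrite ler_wpM2l// divr_ge0// sqr_ge0.
  rewrite lE; lra.
- by rewrite mulr_ge0.
- by rewrite mulr_ge0// ltW.
- by rewrite ler_wpM2r// ltW.
- by rewrite -mulrDl.
- by rewrite lerD2l ler_wpM2r//; lra.
- apply: le_trans C1.
  (* [(k - h) ^+ 2 - k ^+ 2] is nonpositive, so the variance is needed from below; on the other side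
     of the window it is needed from above. *)
  have : (2 * k * h - h ^+ 2) * r ^+ 2 / 2 * (n * lo) <= (2 * k * h - h ^+ 2) * r ^+ 2 / 2 * s2.
    apply: ler_wpM2l => //; apply: divr_ge0 => //; apply: mulr_ge0; last exact: sqr_ge0.
    nra.
  rewrite lE; lra.
- apply: le_trans C2.
  have : (2 * k * h + h ^+ 2) * r ^+ 2 / 2 * s2 <= (2 * k * h + h ^+ 2) * r ^+ 2 / 2 * (n * hi).
    apply: ler_wpM2l => //; apply: divr_ge0 => //; apply: mulr_ge0; last exact: sqr_ge0.
    nra.
  rewrite lE; lra.
Qed.

Lemma lower_half (b c k1 k h tau y : R) : 0 <= c -> 0 <= d ->
  0 <= k1 -> k1 * r <= 2^-1 ->
  0 <= h -> h <= k -> (k + h) * r <= 2^-1 -> 0 <= y ->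
  b + K * d / (1 - K * r) + r <= tau ->
  let lo := (1 - K * r) * d - r ^+ 2 in
  let hi := d / (1 - K * r) in
  l * (h * tau + (h ^+ 2 - 2 * k * h) / 2 * lo + 6 * (k + h) ^+ 3 * r) <= - 2 ->
  l * (- h * (tau + 2 * y) + (h ^+ 2 + 2 * k * h) / 2 * hi + 6 * (k + h) ^+ 3 * r) <= - 2 ->
  s ord_max <= 1 + c * r -> (0 < #|strong_players|)%N ->
  1 - qprob s (strong_lose (N := N)) <=
  expR (l * (k1 * (c * d - b) + k1 ^+ 2 / 8 + 3 * k1 ^+ 3 * r)) +
  2 * (#|strong_players|%:R)^-1 *
     expR (- (l * (- k * (tau + 2 * y) + k ^+ 2 / 2 * lo - 3 * k ^+ 3 * r))).
Proof.
move=> c0 d0 k10 k1r h0 hk khr y0 tauE lo hi C1 C2 cs card0.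
have AN i : strong_players i -> (i < N)%N by case/andP.
apply: le_trans (compl_strong_lose s s_gt0 (f 1 + b * n * r) _ AN) _.
apply: lerD; first exact: challenger_ge.
set e := l * (- k * _ + _ - _).
pose mu := \sum_(i in strong_players) E (fun x => (f 1 + b * n * r <= (score x i)%:R)%R%:R).
have muE : #|strong_players|%:R * (2^-1 * expR e) <= mu.
  rewrite mulr_natl -sumr_const; apply: ler_sum => i iS.
  exact: (strong_player_lower b k h tau y i).
have card0' : 0 < #|strong_players|%:R :> R by rewrite ltr0n.
have e0 : 0 < #|strong_players|%:R * (2^-1 * expR e) by rewrite !mulr_gt0// ?expR_gt0.
have mu0 : 0 < mu by apply: lt_le_trans muE.
apply: (@le_trans _ _ mu^-1).
  apply: (second_moment (matchp s) (matchp01 s s_gt0) _ strong_players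
    (fun i x => f 1 + b * n * r <= (score x i)%:R)) => //.
  by move=> i k' _ _ ik; exact: score_anticoordinate.
apply: (@le_trans _ _ (#|strong_players|%:R * (2^-1 * expR e))^-1).
  by rewrite lef_pV2 ?posrE.
by rewrite !invfM invrK expRN mulrCA mulrA.
Qed.

End QuantitativeBounds.

(** * Limits for a fixed sequence of strengths *)

Definition rate {R : realType} (N : nat) : R := Num.sqrt (ln N%:R / N%:R).

Definition lnn {R : realType} (N : nat) : R := ln N%:R.

Section Asymptotics.
Context {R : realType}.

Lemma ln_le_sub1 (x : R) : 0 < x -> ln x <= x - 1.
Proof.
by move=> x0; have := expR_ge1Dx (ln x); rewrite lnK ?posrE//; lra.
Qed.

Lemma lnn_cvg : lnn (R := R) N @[N --> \oo] --> +oo.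
Proof.
apply/cvgryPge => A; near=> n.
have : expR A <= n%:R by near: n; exact: nbhs_infty_ger.
by move=> h; rewrite /lnn -[A]expRK ler_ln ?posrE ?expR_gt0//; apply: lt_le_trans h; exact: expR_gt0.
Unshelve. all: by end_near. Qed.

Lemma lnn_rate N : (0 < N)%N -> lnn N = N%:R * rate N ^+ 2 :> R.
Proof.
move=> N0; have n0 : 0 < N%:R :> R by rewrite ltr0n.
rewrite /rate sqr_sqrtr; first by rewrite mulrCA divff ?mulr1// lt0r_neq0.
by rewrite divr_ge0 ?ler0n// ln_ge0// ler1n.
Qed.

Lemma rate_ge0 N : 0 <= rate N :> R.
Proof. exact: sqrtr_ge0. Qed.

Lemma rate_gt0 N : (1 < N)%N -> 0 < rate N :> R.
Proof.
move=> N1; rewrite sqrtr_gt0 divr_gt0 ?ltr0n ?(ltn_trans _ N1)//.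
by rewrite ln_gt0// ltr1n.
Qed.

Lemma rate_cvg : rate (R := R) N @[N --> \oo] --> (0 : R).
Proof.
apply/cvgrPdist_le => e e0; near=> n.
have n1 : (0 < n)%N by near: n; exists 1%N.
have n0 : 0 < n%:R :> R by rewrite ltr0n.
rewrite sub0r normrN ger0_norm ?rate_ge0//.
rewrite -[e]gtr0_norm// -sqrtr_sqr /rate ler_wsqrtr//.
(* With [u] the square root of [n], the ratio [ln n / n = 2 * ln u / u ^+ 2] is at most [2 / u],
   hence at most [e ^+ 2] once [2 / e ^+ 2 <= u]. *)
have big : (2 / e ^+ 2) ^+ 2 <= n%:R by near: n; exact: nbhs_infty_ger.
set u := Num.sqrt (n%:R : R).
have u2 : u ^+ 2 = n%:R by rewrite sqr_sqrtr// ltW.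
have u0 : 0 < u by rewrite sqrtr_gt0.
have e20 : 0 < e ^+ 2 by rewrite exprn_gt0.
have ue : 2 / e ^+ 2 <= u.
  rewrite -(@ler_pXn2r _ 2)// ?nnegrE; [by rewrite u2| |exact: ltW].
  by rewrite divr_ge0// ltW.
rewrite ler_pdivrMr// -u2 lnXn// -mulr_natl.
have h1 := ln_le_sub1 u u0.
rewrite ler_pdivrMr// in ue.
have : u * 2 <= u * (u * e ^+ 2) by rewrite ler_wpM2l// ltW.
rewrite -/u; lra.
Unshelve. all: by end_near. Qed.

Lemma mul_lnn_le (A : nat -> R) (a M : R) : A @ \oo --> a -> a < 0 ->
  \forall N \near \oo, lnn N * A N <= M.
Proof.
move=> Aa a0; near=> N.
have h1 : A N < a / 2 by near: N; apply: cvgr_lt; [exact: Aa|lra].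
have h2 : `|M| / (- a / 2) <= lnn N.
  by near: N; move: lnn_cvg => /cvgryPge; apply.
have l0 : 0 <= lnn N :> R by apply: le_trans h2; rewrite divr_ge0//; lra.
rewrite ler_pdivrMr in h2; last lra.
have h3 : lnn N * A N <= lnn N * (a / 2) by rewrite ler_wpM2l// ltW.
have := ler_norm (- M); rewrite normrN; lra.
Unshelve. all: by end_near. Qed.

Lemma expR_lnn_cvg0 (A : nat -> R) (a : R) : A @ \oo --> a -> a < 0 ->
  expR (lnn N * A N) @[N --> \oo] --> (0 : R).
Proof.
move=> Aa a0; apply/cvgrPdist_le => e e0; near=> N.
rewrite sub0r normrN ger0_norm ?expR_ge0// -[e]lnK ?posrE// ler_expR.
by near: N; exact: mul_lnn_le Aa a0.
Unshelve. all: by end_near. Qed.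

Lemma cvg_shrink (d : nat -> R) (theta c : R) : d @ \oo --> theta ->
  d N / (1 - c * rate N) @[N --> \oo] --> theta.
Proof.
move=> dt; rewrite -[X in _ --> X]divr1; apply: cvgM => //; apply: cvgV; first exact: oner_neq0.
rewrite -[X in _ --> X]subr0; apply: cvgB; first exact: cvg_cst.
by rewrite -(mulr0 c); apply: cvgM; [exact: cvg_cst|exact: rate_cvg].
Qed.

Lemma rate_cvg0 (a : R) : a * rate N @[N --> \oo] --> (0 : R).
Proof. by rewrite -(mulr0 a); apply: cvgM; [exact: cvg_cst|exact: rate_cvg]. Qed.

Lemma near_rate_le (k e : R) : 0 < e -> \forall N \near \oo, k * rate N <= e.
Proof. by move=> e0; near=> N; apply: ltW; near: N; apply: cvgr_lt; [exact: rate_cvg0|]. Unshelve. all: by end_near. Qed.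

Lemma cvg_compl0 (q : nat -> R) : (fun N => 1 - q N) @ \oo --> (0 : R) ->
  q @ \oo --> (1 : R).
Proof.
move=> h; have -> : q = (fun N => 1 - (1 - q N)).
  by apply/funext => N; rewrite opprB addrC subrK.
by rewrite -[X in _ --> X]subr0; apply: cvgB => //; exact: cvg_cst.
Qed.

End Asymptotics.

Lemma qprob_le1 {R : realType} {N : nat} (s : 'I_N.+1 -> R) (E : pred (outcome N)) :
  (forall i, 0 < s i) -> qprob s E <= 1.
Proof.
move=> s0; rewrite qprobE// -[leRHS](bmean_cst (matchp s)).
apply: bmean_le => [|x]; first exact: matchp01.
by case: (E x); rewrite ?lexx ?ler01.
Qed.

Section QuenchedLimits.
Context {R : realType} (S : forall N : nat, 'I_N.+1 -> R) (theta e0 rho : R).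
Arguments S : clear implicits.
Hypothesis S_gt0 : forall N i, (0 < N)%N -> 0 < S N i.
Hypothesis S_le1 : forall N (i : 'I_N.+1), (i < N)%N -> S N i <= 1.
Hypothesis theta_gt0 : 0 < theta.
Hypothesis e0_gt0 : 0 < e0.
Hypothesis rhoE : e0 ^+ 2 * theta = 2 * rho.

Let d N := strength_info (S N) / N%:R.
Hypothesis info_cvg : d @ \oo --> theta.

Lemma rho_gt0 : 0 < rho.
Proof.
have : 0 < e0 ^+ 2 * theta by rewrite mulr_gt0// exprn_gt0.
rewrite rhoE; lra.
Qed.

(** At [c'] times the critical height, a strong player reaches the threshold with exponent
    [- (c' ^+ 2 * rho)]. Half of the surplus [(c' ^+ 2 - 1) * rho] is granted to the count, the
    other half makes the sum vanish. *)
Lemma upper_limit (c : R) : 1 < c ->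
  let c' := (1 + c) / 2 in
  (\forall N \near \oo, #|strong_players (S N) (rate N) (3 / theta)|%:R <=
      expR (lnn N * (rho + (c' ^+ 2 - 1) * rho / 2))) ->
  (\forall N \near \oo, 1 + c * e0 * rate N <= S N ord_max) ->
  (fun N => qprob (S N) (@strong_win N)) @ \oo --> (1 : R).
Proof.
move=> c1 c' card_le v_ge.
have rho0 := rho_gt0.
have c'1 : 1 < c' by rewrite /c'; lra.
have c'c : c' < c by rewrite /c'; lra.
(* [g] is the distance from [b] up to the challenger's height [c * e0 * theta]. [K * theta = 3] puts
   the limiting exponent of a weak player, with tilt 1, below - 1, which beats the N players. *)
pose b := c' * e0 * theta; pose g := (c - c') * e0 * theta; pose K := 3 / theta.
have et0 : 0 < e0 * theta by rewrite mulr_gt0.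
have b0 : 0 < b by rewrite /b -mulrA mulr_gt0//; lra.
have g0 : 0 < g by rewrite /g -mulrA mulr_gt0//; lra.
have K0 : 0 < K by rewrite divr_gt0.
(* The minimizers of [- k * g + k ^+ 2 / 8] and of [- k * b + k ^+ 2 * theta / 2]. *)
pose k1 := 4 * g; pose k2 := b / theta.
have k10 : 0 <= k1 by rewrite /k1; lra.
have k20 : 0 <= k2 by rewrite /k2 divr_ge0// ltW.
pose A1 N := k1 * (b + rate N - c * e0 * d N / (1 + c * e0 * rate N)) + k1 ^+ 2 / 8 + 3 * k1 ^+ 3 * rate N.
pose A2 N := - k2 * b + k2 ^+ 2 * d N / (2 * (1 - K * rate N)) + 3 * k2 ^+ 3 * rate N.
pose A3 N := - 1 * (b + K * d N) + 1 ^+ 2 / 8 + 3 * 1 ^+ 3 * rate N.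
have A1_cvg : A1 @ \oo --> - 2 * g ^+ 2.
  have -> : - 2 * g ^+ 2 = k1 * (b + 0 - c * e0 * theta) + k1 ^+ 2 / 8 + 0.
    by rewrite /k1 /g /b; field.
  apply: cvgD; last exact: rate_cvg0.
  apply: cvgD; last exact: cvg_cst.
  apply: cvgM; first exact: cvg_cst.
  apply: cvgB; first by apply: cvgD; [exact: cvg_cst|exact: rate_cvg].
  have h := cvg_shrink d theta (- (c * e0)) info_cvg.
  rewrite (_ : (fun N => _) = (fun N => c * e0 * (d N / (1 - - (c * e0) * rate N)))); last first.
    by apply/funext => N; rewrite mulNr opprK mulrA.
  by apply: cvgM; first exact: cvg_cst.
have A2_cvg : A2 @ \oo --> - (c' ^+ 2 * rho).
  have -> : - (c' ^+ 2 * rho) = - k2 * b + k2 ^+ 2 / 2 * theta + 0.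
    have -> : rho = e0 ^+ 2 * theta / 2 by rewrite rhoE; lra.
    by rewrite /k2 /b; field; exact: lt0r_neq0.
  apply: cvgD; last exact: rate_cvg0.
  apply: cvgD; first exact: cvg_cst.
  rewrite (_ : (fun N => _) = (fun N => k2 ^+ 2 / 2 * (d N / (1 - K * rate N)))); last first.
    by apply/funext => N; rewrite invfM; ring.
  by apply: cvgM; [exact: cvg_cst|exact: cvg_shrink].
have A3_cvg : A3 @ \oo --> - 1 * (b + 3) + 1 ^+ 2 / 8 + 0.
  apply: cvgD; last exact: rate_cvg0.
  apply: cvgD; last exact: cvg_cst.
  apply: cvgM; first exact: cvg_cst.
  apply: cvgD; first exact: cvg_cst.
  have -> : 3 = K * theta by rewrite /K; field; exact: lt0r_neq0.
  by apply: cvgM; first exact: cvg_cst.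
set eta := (c' ^+ 2 - 1) * rho / 2 in card_le.
have c'2 : 1 < c' ^+ 2 by rewrite expr2; nra.
have E1 : expR (lnn N * A1 N) @[N --> \oo] --> (0 : R).
  by apply: expR_lnn_cvg0 A1_cvg _; have := exprn_gt0 2 g0; lra.
have E2 : expR (lnn N * (rho + eta + A2 N)) @[N --> \oo] --> (0 : R).
  apply: (expR_lnn_cvg0 _ (rho + eta + - (c' ^+ 2 * rho))).
    by apply: cvgD => //; exact: cvg_cst.
  have : 0 < (c' ^+ 2 - 1) * rho by rewrite mulr_gt0//; lra.
  rewrite /eta; lra.
have E3 : expR (lnn N * (1 + A3 N)) @[N --> \oo] --> (0 : R).
  apply: (expR_lnn_cvg0 _ (1 + (- 1 * (b + 3) + 1 ^+ 2 / 8 + 0))).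
    by apply: cvgD => //; exact: cvg_cst.
  lra.
have E123 : expR (lnn N * A1 N) + (expR (lnn N * (rho + eta + A2 N)) +
    expR (lnn N * (1 + A3 N))) @[N --> \oo] --> (0 : R).
  have -> : 0 = 0 + (0 + 0) :> R by rewrite !addr0.
  by apply: cvgD => //; apply: cvgD.
apply: cvg_compl0.
apply: (squeeze_cvgr _ (cvg_cst 0) E123).
near=> N.
have N1 : (1 < N)%N by near: N; exists 2%N.
have N0 : (0 < N)%N by apply: ltn_trans N1.
have n0 : 0 < N%:R :> R by rewrite ltr0n.
have SN0 i : 0 < S N i by exact: S_gt0.
have l1 : 1 <= lnn N :> R by near: N; move: (@lnn_cvg R) => /cvgryPge; apply.
have dE : strength_info (S N) = N%:R * d N by rewrite /d mulrCA divff ?mulr1// lt0r_neq0.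
have d0 : 0 <= d N by rewrite divr_ge0 ?ler0n// strength_info_ge0.
have Kr : K * rate N < 1.
  by apply: (@le_lt_trans _ _ 2^-1); last lra; near: N; apply: near_rate_le; lra.
have k1r : k1 * rate N <= 2^-1 by near: N; apply: near_rate_le; lra.
have k2r : k2 * rate N <= 2^-1 by near: N; apply: near_rate_le; lra.
have k3r : 1 * rate N <= 2^-1 :> R by near: N; apply: near_rate_le; lra.
have cardN : #|strong_players (S N) (rate N) K|%:R <= expR (lnn N * (rho + eta)) by near: N.
have vN : 1 + c * e0 * rate N <= S N ord_max by near: N.
have c0 : 0 <= c * e0 by apply: mulr_ge0; apply: ltW => //; lra.
apply/andP; split; first by rewrite subr_ge0 qprob_le1.
have UH := upper_half (S N) (rate N) (lnn N) (d N) K SN0 (@S_le1 N) (rate_gt0 N N1) (lnn_rate N N0)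
  l1 dE Kr b (c * e0) k1 k2 1 (ltW b0) c0 d0 k10 k1r k20 k2r ler01 k3r vN.
apply: (le_trans UH).
rewrite lerD2l; apply: lerD.
  rewrite [X in _ <= expR X]mulrDr expRD -/(A2 N).
  by rewrite ler_wpM2r ?expR_ge0.
rewrite [X in _ <= expR X]mulrDr expRD mulr1 -/(A3 N) {1}/lnn lnK ?posrE//.
Unshelve. all: by end_near. Qed.

(** [g] is half the gap between the challenger's height [c * e0 * theta] and the critical height
    [e0 * theta]. The latter costs the exponent [(e0 * theta) ^+ 2 / (2 * theta) = rho]; [eta] is
    half of what is saved by aiming at [e0 * theta - g / 2] instead. *)
Lemma lower_limit (c : R) : 0 < c < 1 ->
  let g := (1 - c) / 2 * (e0 * theta) in
  let K := g / (10 * theta) in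
  let eta := ((e0 * theta) ^+ 2 - (e0 * theta - g / 2) ^+ 2) / (4 * theta) in
  (\forall N \near \oo, expR (lnn N * (rho - eta)) <=
     #|strong_players (S N) (rate N) K|%:R) ->
  (\forall N \near \oo, S N ord_max <= 1 + c * e0 * rate N) ->
  (fun N => qprob (S N) (@strong_lose N)) @ \oo --> (1 : R).
Proof.
move=> /andP[c0 c1] g K eta card_ge v_le.
have rho0 := rho_gt0.
have et0 : 0 < e0 * theta by rewrite mulr_gt0.
have g0 : 0 < g by rewrite /g mulr_gt0//; lra.
have gT : g < e0 * theta by rewrite /g gtr_pMl//; lra.
have K0 : 0 < K by rewrite divr_gt0// mulr_gt0.
have Kt : K * theta = g / 10 by rewrite /K; field; exact: lt0r_neq0.
have ceE : c * e0 * theta = e0 * theta - 2 * g by rewrite /g; lra.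
clearbody g.
(* As [K * theta = g / 10], the threshold exceeds the mean of a strong player by at most
   [b + g / 10] in the limit, which is less than [tau]. The window from [tau] to [tau + 2 * y] stays
   below [e0 * theta - g / 2]. *)
pose b := e0 * theta - g; pose y := g / 10; pose tau := b + g / 5.
(* [k] tilts to the middle [tau + y] of the window, and [h] minimizes
   [- h * y + h ^+ 2 * theta / 2], the limiting exponent on either side of it. *)
pose k := (tau + y) / theta; pose h := y / theta; pose k1 := 4 * g.
have kt : k * theta = tau + y by rewrite /k divfK// lt0r_neq0.
have ht : h * theta = y by rewrite /h divfK// lt0r_neq0.
have h0 : 0 < h by rewrite divr_gt0// /y; lra.
have y0 : 0 < y by rewrite /y; lra.
have hk : h <= k by rewrite ler_pM2r ?invr_gt0// /tau /b; lra.
have k10 : 0 <= k1 by rewrite /k1; lra.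
pose lo N := (1 - K * rate N) * d N - rate N ^+ 2.
pose hi N := d N / (1 - K * rate N).
have lo_cvg : lo @ \oo --> theta.
  have -> : theta = (1 - 0) * theta - 0 * 0 by rewrite mul0r !subr0 mul1r.
  apply: cvgB; last by apply: cvgM; exact: rate_cvg.
  by apply: cvgM => //; apply: cvgB; [exact: cvg_cst|exact: rate_cvg0].
have hi_cvg : hi @ \oo --> theta by exact: cvg_shrink.
pose A1 N := k1 * (c * e0 * d N - b) + k1 ^+ 2 / 8 + 3 * k1 ^+ 3 * rate N.
pose C1 N := h * tau + (h ^+ 2 - 2 * k * h) / 2 * lo N + 6 * (k + h) ^+ 3 * rate N.
pose C2 N := - h * (tau + 2 * y) + (h ^+ 2 + 2 * k * h) / 2 * hi N + 6 * (k + h) ^+ 3 * rate N.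
pose B N := - k * (tau + 2 * y) + k ^+ 2 / 2 * lo N - 3 * k ^+ 3 * rate N.
have A1_cvg : A1 @ \oo --> - 2 * g ^+ 2.
  have -> : - 2 * g ^+ 2 = k1 * (c * e0 * theta - b) + k1 ^+ 2 / 8 + 0.
    by rewrite ceE /k1 /b; field.
  apply: cvgD; last exact: rate_cvg0.
  apply: cvgD; last exact: cvg_cst.
  apply: cvgM; first exact: cvg_cst.
  apply: cvgB; last exact: cvg_cst.
  by apply: cvgM; first exact: cvg_cst.
have C1_cvg : C1 @ \oo --> - (h * y / 2).
  have -> : - (h * y / 2) = h * tau + (h ^+ 2 - 2 * k * h) / 2 * theta + 0.
    have -> : (h ^+ 2 - 2 * k * h) / 2 * theta = h * (h * theta) / 2 - h * (k * theta) by field.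
    by rewrite kt ht; field.
  apply: cvgD; last exact: rate_cvg0.
  apply: cvgD; first exact: cvg_cst.
  by apply: cvgM; first exact: cvg_cst.
have C2_cvg : C2 @ \oo --> - (h * y / 2).
  have -> : - (h * y / 2) = - h * (tau + 2 * y) + (h ^+ 2 + 2 * k * h) / 2 * theta + 0.
    have -> : (h ^+ 2 + 2 * k * h) / 2 * theta = h * (h * theta) / 2 + h * (k * theta) by field.
    by rewrite kt ht; field.
  apply: cvgD; last exact: rate_cvg0.
  apply: cvgD; first exact: cvg_cst.
  by apply: cvgM; first exact: cvg_cst.
have B_cvg : B @ \oo --> - k * (tau + 2 * y) + k ^+ 2 / 2 * theta - 0.
  apply: cvgB; last exact: rate_cvg0.
  apply: cvgD; first exact: cvg_cst.
  by apply: cvgM; first exact: cvg_cst.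
have E1 : expR (lnn N * A1 N) @[N --> \oo] --> (0 : R).
  by apply: expR_lnn_cvg0 A1_cvg _; have := exprn_gt0 2 g0; lra.
have E2 : expR (lnn N * (- rho + eta - B N)) @[N --> \oo] --> (0 : R).
  apply: (expR_lnn_cvg0 _ (- rho + eta - (- k * (tau + 2 * y) + k ^+ 2 / 2 * theta - 0))).
    by apply: cvgB => //; exact: cvg_cst.
  rewrite subr0.
  (* The cost exponent is [(tau + y) * (tau + 3 * y) / (2 * theta)], less than
     [(tau + 2 * y) ^+ 2 / (2 * theta)] and hence than [rho - 2 * eta]. *)
  have -> : - k * (tau + 2 * y) + k ^+ 2 / 2 * theta = - (k * (tau + 3 * y) / 2).
    have -> : k ^+ 2 / 2 * theta = k * (k * theta) / 2 by field.
    by rewrite kt; field.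
  rewrite -(ltr_pM2r theta_gt0) mul0r.
  have -> : (- rho + eta - - (k * (tau + 3 * y) / 2)) * theta =
     - (2 * rho) * theta / 2 + eta * theta + (k * theta) * (tau + 3 * y) / 2 by field.
  rewrite -rhoE kt.
  have -> : eta * theta = ((e0 * theta) ^+ 2 - (e0 * theta - g / 2) ^+ 2) / 4.
    by rewrite /eta; field; exact: lt0r_neq0.
  rewrite /tau /y /b; nra.
have E12 : expR (lnn N * A1 N) + 2 * expR (lnn N * (- rho + eta - B N)) @[N --> \oo] --> (0 : R).
  have -> : 0 = 0 + 2 * 0 :> R by rewrite mulr0 addr0.
  by apply: cvgD => //; apply: cvgM => //; exact: cvg_cst.
apply: cvg_compl0.
apply: (squeeze_cvgr _ (cvg_cst 0) E12).
have tau_cvg : b + K * hi N + rate N @[N --> \oo] --> b + K * theta + 0.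
  apply: cvgD; last exact: rate_cvg.
  by apply: cvgD; [exact: cvg_cst|apply: cvgM; first exact: cvg_cst].
near=> N.
have N1 : (1 < N)%N by near: N; exists 2%N.
have N0 : (0 < N)%N by apply: ltn_trans N1.
have n0 : 0 < N%:R :> R by rewrite ltr0n.
have SN0 i : 0 < S N i by exact: S_gt0.
have l1 : 1 <= lnn N :> R by near: N; move: (@lnn_cvg R) => /cvgryPge; apply.
have dE : strength_info (S N) = N%:R * d N by rewrite /d mulrCA divff ?mulr1// lt0r_neq0.
have d0 : 0 <= d N by rewrite divr_ge0 ?ler0n// strength_info_ge0.
have Kr : K * rate N < 1.
  by apply: (@le_lt_trans _ _ 2^-1); last lra; near: N; apply: near_rate_le; lra.
have k1r : k1 * rate N <= 2^-1 by near: N; apply: near_rate_le; lra.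
have khr : (k + h) * rate N <= 2^-1 by near: N; apply: near_rate_le; lra.
have cardN : expR (lnn N * (rho - eta)) <= #|strong_players (S N) (rate N) K|%:R by near: N.
have vN : S N ord_max <= 1 + c * e0 * rate N by near: N.
have ce0 : 0 <= c * e0 by apply: mulr_ge0; apply: ltW.
have C1N : lnn N * C1 N <= - 2.
  by near: N; apply: mul_lnn_le C1_cvg _; have := mulr_gt0 h0 y0; lra.
have C2N : lnn N * C2 N <= - 2.
  by near: N; apply: mul_lnn_le C2_cvg _; have := mulr_gt0 h0 y0; lra.
have tauN : b + K * d N / (1 - K * rate N) + rate N <= tau.
  rewrite -mulrA; apply: ltW; near: N; apply: cvgr_lt; first exact: tau_cvg.
  by rewrite Kt /tau; lra.
apply/andP; split; first by rewrite subr_ge0 qprob_le1.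
have card0 : 0 < #|strong_players (S N) (rate N) K|%:R :> R.
  by apply: lt_le_trans cardN; exact: expR_gt0.
apply: le_trans (lower_half (S N) (rate N) (lnn N) (d N) K SN0 (@S_le1 N) (rate_gt0 N N1) (lnn_rate N N0)
  l1 dE (ltW K0) Kr b (c * e0) k1 k h tau y ce0 d0 k10 k1r (ltW h0) hk khr (ltW y0) tauN C1N C2N vN _) _.
  by rewrite -(ltr0n R).
rewrite lerD2l -mulrA ler_pM2l//.
have -> : lnn N * (- rho + eta - B N) = - (lnn N * (rho - eta)) - lnn N * B N by ring.
rewrite expRD ler_wpM2r ?expR_ge0// expRN lef_pV2 ?posrE ?expR_gt0//.
Unshelve. all: by end_near. Qed.

End QuenchedLimits.

(** * Counting independent events *)

Lemma measurable_RV_preimage {R : realType} {d : measure_display}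
  {T : measurableType d} (P : probability T R) (X : {RV P >-> R}) (B : set R) :
  measurable B -> measurable (X @^-1` B).
Proof. by move=> mB; rewrite -[_ @^-1` _]setTI; exact: measurable_funP. Qed.

Section Counts.
Context {R : realType} {d : measure_display} {T : measurableType d}
  (P : probability T R) (U : nat -> {RV P >-> R}).
Hypothesis iidU : iid_RVs U.

Definition pattern (N : nat) (B : set R) (w : T) : {ffun 'I_N -> bool} :=
  [ffun k : 'I_N => U k w \in B].

Definition hits (N : nat) (B : set R) (w : T) : R := \sum_(k < N) (U k w \in B)%:R.

Definition prob_of (B : set R) : R := fine (P (U 0%N @^-1` B)).

Lemma prob_ofE k B : measurable B -> P (U k @^-1` B) = (prob_of B)%:E.
Proof.
move=> mB; rewrite /prob_of -(iidU.2 k) // fineK// fin_num_measure//.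
exact: measurable_RV_preimage.
Qed.

Lemma prob_of01 B : measurable B -> 0 <= prob_of B <= 1.
Proof.
move=> mB; rewrite -2!lee_fin -(prob_ofE 0 B mB) measure_ge0/= probability_le1//.
exact: measurable_RV_preimage.
Qed.

(** The event is a finite union of cylinders, whose probabilities are Bernoulli weights by
    independence. Only upper bounds are wanted, so subadditivity suffices. *)
Lemma pattern_le N B (E : pred {ffun 'I_N -> bool}) : measurable B ->
  measurable [set w | E (pattern N B w)] /\
  (P [set w | E (pattern N B w)] <=
    (bmean (fun _ : 'I_N => prob_of B) (fun x => (E x)%:R))%:E)%E.
Proof.
move=> mB; set q := prob_of B.
pose C (x : {ffun 'I_N -> bool}) (k : nat) : set R :=
  if insub k is Some i then (if x i then B else ~` B) else setT.
have mC x k : measurable (C x k).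
  by rewrite /C; case: insub => // i; case: (x i) => //; exact: measurableC.
pose F x := \big[setI/setT]_(k < N) (U k @^-1` C x k).
have mF x : measurable (F x).
  by apply: bigsetI_measurable => k _; exact: measurable_RV_preimage.
have PF x : P (F x) = (bweight (fun _ : 'I_N => q) x)%:E.
  rewrite iidU.1// /bweight -prodEFin; apply: eq_bigr => k _.
  rewrite prob_ofE//; congr EFin; rewrite /C.
  case: insubP => [i _ ik|]; last by rewrite ltn_ord.
  have -> : i = k by exact: val_inj.
  case: (x k) => //; apply: EFin_inj; rewrite -(prob_ofE 0)//; last exact: measurableC.
  rewrite -preimage_setC probability_setC; last exact: measurable_RV_preimage.
  by rewrite (prob_ofE 0).
have FI x : F x = \bigcap_(k < N) (U k @^-1` C x k) by rewrite /F bigcap_mkord.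
have -> : [set w | E (pattern N B w)] = \big[setU/set0]_(x in E) F x.
  rewrite -bigcup_pred; apply/seteqP; split=> w /=.
    move=> Ew; exists (pattern N B w); first by [].
    rewrite FI => k /= kN; rewrite /C insubT /= ffunE /=.
    by case: ifPn => [|/negP UB h]; [rewrite inE|apply: UB; rewrite inE].
  move=> [x /= xE]; rewrite FI => Fx.
  suff -> : pattern N B w = x by [].
  apply/ffunP => k; rewrite ffunE; have := Fx k (ltn_ord k).
  rewrite /C /=; case: insubP => [i _ ik|]; last by rewrite ltn_ord.
  have -> : i = k by exact: val_inj.
  by case: (x k) => h; [exact: mem_set|exact: memNset].
(* Measurability and bound travel together through the union, since subadditivity asks for
   measurable sets. *)
pose good (A : set T) (v : \bar R) := measurable A /\ (P A <= v)%E.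
suff : good (\big[setU/set0]_(x in E) F x) (\sum_(x in E) P (F x))%E.
  rewrite /good => -[m1 m2]; split=> //; apply: le_trans m2 _.
  rewrite (eq_bigr (fun x => (bweight (fun _ : 'I_N => q) x)%:E)) ?sumEFin//.
  rewrite lee_fin /bmean big_mkcond; apply: ler_sum => x _.
  by rewrite unfold_in; case: (E x); rewrite ?mulr1 ?mulr0.
apply: (big_ind2 good) => //.
- by split; rewrite ?measure0.
- move=> A a A' a' [mA Aa] [mA' Aa']; split; first exact: measurableU.
  by apply: le_trans (measureU2 _ mA mA') _; exact: leeD.
Qed.

Lemma hits_pattern N B w : hits N B w = \sum_(k < N) (pattern N B w k)%:R.
Proof. by apply: eq_bigr => k _; rewrite ffunE. Qed.

(** A Poisson-type bound, whose exponent is proportional to the mean [N * q]. For the rare events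
    near the top an error of order [N * lam ^+ 3], as in [sharp_mgf_sum], could exceed that mean. *)
Lemma binomial_mgf (N : nat) (q lam : R) : 0 <= q <= 1 ->
  bmean (fun _ : 'I_N => q) (fun x => expR (lam * \sum_(k < N) (x k)%:R)) <=
  expR (N%:R * (q * (expR lam - 1))).
Proof.
move=> /andP[q0 q1].
rewrite (eq_bmean _ _ (fun x => \prod_(k < N) expR (lam * (x k)%:R))); last first.
  by move=> x; rewrite mulr_sumr expR_sum.
rewrite (bmean_prod_all _ (fun _ b => expR (lam * b%:R)))/=.
rewrite [leLHS]prodr_const card_ord expRM_natl lerXn2r ?nnegrE ?expR_ge0//.
  by rewrite mulr0 mulr1 expR0 mulr1 addr_ge0 ?mulr_ge0 ?expR_ge0// subr_ge0.
rewrite mulr0 mulr1 expR0 mulr1.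
by apply: le_trans (expR_ge1Dx _); lra.
Qed.

Lemma hits_ge N B (t lam : R) : measurable B -> 0 <= lam ->
  measurable [set w | (t <= hits N B w)%R] /\
  (P [set w | (t <= hits N B w)%R] <=
   (expR (N%:R * (prob_of B * (expR lam - 1)) - lam * t))%:E)%E.
Proof.
move=> mB lam0.
have [m1 m2] := pattern_le N B (fun x => t <= \sum_(k < N) (x k)%:R) mB.
have E : [set w | (t <= \sum_(k < N) (pattern N B w k)%:R)%R] = [set w | (t <= hits N B w)%R].
  by apply/seteqP; split=> w /=; rewrite hits_pattern.
rewrite E in m1 m2; split=> //; apply: le_trans m2 _; rewrite lee_fin.
have q01 := prob_of01 B mB.
apply: le_trans (bmean_markov _ (fun _ => q01) _ _ _ lam0) _.
rewrite addrC expRD ler_wpM2l ?expR_ge0//; exact: binomial_mgf.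
Qed.

Lemma hits_le N B (t lam : R) : measurable B -> 0 <= lam ->
  measurable [set w | (hits N B w <= t)%R] /\
  (P [set w | (hits N B w <= t)%R] <=
   (expR (N%:R * (prob_of B * (expR (- lam) - 1)) + lam * t))%:E)%E.
Proof.
move=> mB lam0.
have [m1 m2] := pattern_le N B (fun x => \sum_(k < N) (x k)%:R <= t) mB.
have E : [set w | (\sum_(k < N) (pattern N B w k)%:R <= t)%R] = [set w | (hits N B w <= t)%R].
  by apply/seteqP; split=> w /=; rewrite hits_pattern.
rewrite E in m1 m2; split=> //; apply: le_trans m2 _; rewrite lee_fin.
have q01 := prob_of01 B mB.
apply: le_trans (bmean_markov_le _ (fun _ => q01) _ _ _ lam0) _.
rewrite addrC expRD ler_wpM2l ?expR_ge0//; exact: binomial_mgf.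
Qed.

(** [expR (- 2 * lnn n)] is n^-2, at most 2 (1/n - 1/(n+1)); the series telescopes, after initial
    terms bounded by 1. *)
Lemma borel_cantelli (F : nat -> set T) : (forall N, measurable (F N)) ->
  (\forall N \near \oo, (P (F N) <= (expR (- 2 * lnn N))%:E)%E) ->
  {ae P, forall w, \forall N \near \oo, ~ F N w}.
Proof.
move=> mF [N0 _ FN0].
pose M := N0.+1.
have bnd n : (M <= n)%N -> (P (F n) <= (2 * (n%:R^-1 - n.+1%:R^-1))%:E)%E.
  move=> Mn; have n0 : 0 < n%:R :> R by rewrite ltr0n; apply: leq_trans Mn.
  apply: le_trans (FN0 n _) _; first by rewrite /= ltnW.
  rewrite lee_fin.
  have -> : expR (- 2 * lnn n) = n%:R ^- 2 :> R.
    by rewrite /lnn mulNr expRN expRM_natl lnK.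
  have -> : 2 * (n%:R^-1 - n.+1%:R^-1) = 2 / (n%:R * (n%:R + 1)) :> R.
    by rewrite -natr1; field; apply/andP; split; apply: lt0r_neq0; lra.
  have n1 : 1 <= n%:R :> R by rewrite ler1n; apply: leq_trans Mn.
  rewrite -[leLHS]mul1r ler_pdivrMr ?exprn_gt0// mulrAC ler_pdivlMr; nra.
have part n : (M <= n)%N ->
    (\sum_(0 <= k < n) P (F k) <= (M%:R + (2 - 2 * n%:R^-1))%:E)%E.
  elim: n => // n IH; rewrite leq_eqVlt => /predU1P[<-|].
    apply: (@le_trans _ _ (\sum_(0 <= k < M) 1%:E)%E).
      by apply: lee_sum => k _; exact: probability_le1.
    rewrite sumEFin lee_fin sumr_const_nat subn0 /M.
    rewrite lerDl subr_ge0 -[leRHS]mulr1 ler_wpM2l// invf_le1 ?ltr0n// ler1n//.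
  rewrite ltnS => Mn; rewrite big_nat_recr//=.
  apply: le_trans (leeD (IH Mn) (bnd n Mn)) _.
  rewrite -EFinD lee_fin; move: (n%:R^-1) (n.+1%:R^-1) => a b; lra.
have sumfin : (\sum_(0 <= n <oo) P (F n) < +oo)%E.
  apply: (@le_lt_trans _ _ (M%:R + 2)%:E); last by rewrite ltry.
  apply: lime_le; first by apply: is_cvg_nneseries => *; exact: measure_ge0.
  near=> n; apply: le_trans (part n _) _; first by near: n; exists M.
  by rewrite lee_fin lerD2l gerBl mulr_ge0 ?invr_ge0.
exists (lim_sup_set F); split.
- by apply: bigcap_measurable => // n _; apply: bigcup_measurable.
- exact: lim_sup_set_cvg0 mF sumfin.
- move=> w /= nF n _; apply: contrapT => h; apply: nF; exists n => // k /= nk Fk.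
  by apply: h; exists k.
Unshelve. all: by end_near. Qed.

End Counts.

(** * Growth of powers of N and logarithm of [rate] *)

Section LnGrowth.
Context {R : realType}.

Lemma near_lnn_ge (M : R) : \forall N \near \oo, M <= lnn N.
Proof. by move: (@lnn_cvg R) => /cvgryPge; apply. Qed.

(** Squaring [x <= expR x] at [x = lnn N * a / 2] beats any multiple of [lnn N]. *)
Lemma near_expR_lnn_ge (a M : R) : 0 < a ->
  \forall N \near \oo, M * lnn N <= expR (lnn N * a).
Proof.
move=> a0; near=> N.
have l0 : 0 <= lnn N :> R by near: N; exact: near_lnn_ge.
have lM : 4 * `|M| / a ^+ 2 <= lnn N by near: N; exact: near_lnn_ge.
have -> : lnn N * a = lnn N * a / 2 + lnn N * a / 2 by rewrite -splitr.
rewrite expRD; set x := lnn N * a / 2.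
have x0 : 0 <= x by rewrite /x divr_ge0// mulr_ge0// ltW.
have h1 : x <= expR x by have := expR_ge1Dx x; lra.
have h2 : x * x <= expR x * expR x by rewrite ler_pM.
apply: le_trans h2; rewrite ler_pdivrMr ?exprn_gt0// in lM.
have : M * lnn N <= `|M| * lnn N by rewrite ler_wpM2r// ler_norm.
have : lnn N * (4 * `|M|) <= lnn N * (lnn N * a ^+ 2) by rewrite ler_wpM2l.
rewrite /x; lra.
Unshelve. all: by end_near. Qed.

Lemma near_expR_lnn_cst (a M : R) : 0 < a -> \forall N \near \oo, M <= expR (lnn N * a).
Proof.
move=> a0; near=> N.
have l1 : 1 <= lnn N :> R by near: N; exact: near_lnn_ge.
have h : `|M| * lnn N <= expR (lnn N * a) by near: N; exact: near_expR_lnn_ge.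
apply: le_trans h; apply: le_trans (ler_norm _) _; by rewrite ler_peMr.
Unshelve. all: by end_near. Qed.

(** The logarithm of [rate N] is half of [ln (lnn N) - lnn N], and [ln (lnn N)] is at most twice the
    square root of [lnn N]. The resulting factor 1/2 turns alpha into alpha/2 in the count of strong
    players. *)
Lemma ln_rate (K delta : R) : 0 < K -> 0 < delta ->
  \forall N \near \oo, `|ln (K * rate N) + lnn N / 2| <= delta * lnn N.
Proof.
move=> K0 delta0; near=> N.
have N1 : (1 < N)%N by near: N; exists 2%N.
have n0 : 0 < N%:R :> R by rewrite ltr0n; apply: ltn_trans N1.
have l1 : 1 <= lnn N :> R by near: N; exact: near_lnn_ge.
have l0 : 0 < lnn N :> R by lra.
have lK : 2 * `|ln K| / delta <= lnn N by near: N; exact: near_lnn_ge.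
have lD : (2 / delta) ^+ 2 <= lnn N by near: N; exact: near_lnn_ge.
have r0 := @rate_gt0 R N N1.
have lnr : ln (rate N) = (ln (lnn N) - lnn N) / 2 :> R.
  have : ln (rate N ^+ 2) = ln (lnn N) - lnn N :> R.
    rewrite sqr_sqrtr; last by rewrite divr_ge0 ?ltW.
    by rewrite -/(lnn N) lnM ?posrE ?invr_gt0// lnV ?posrE.
  by rewrite lnXn// mulr2n; lra.
rewrite lnM ?posrE// lnr.
have -> : ln K + (ln (lnn N) - lnn N) / 2 + lnn N / 2 = ln K + ln (lnn N) / 2 by lra.
set s := Num.sqrt (lnn N : R).
have s2 : s ^+ 2 = lnn N by rewrite sqr_sqrtr// ltW.
have s0 : 0 < s by rewrite sqrtr_gt0.
have sD : 2 / delta <= s.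
  rewrite -(@ler_pXn2r _ 2)// ?nnegrE; [by rewrite s2| |exact: ltW].
  by rewrite divr_ge0// ltW.
have lns : ln (lnn N) <= 2 * s.
  by rewrite -s2 lnXn// mulr2n; have := ln_le_sub1 s s0; lra.
have lnl0 : 0 <= ln (lnn N) :> R by exact: ln_ge0.
rewrite ler_pdivrMr// in lK; rewrite ler_pdivrMr// in sD.
have sd : s * 2 <= s * (s * delta) by rewrite ler_wpM2l// ltW.
apply: le_trans (ler_normD _ _) _; rewrite [`|_ / 2|]ger0_norm; last lra.
have : s * (s * delta) = lnn N * delta by rewrite -s2; ring.
lra.
Unshelve. all: by end_near. Qed.

End LnGrowth.

(** * Number of players close to the top *)

Section TailAsymptotics.
Context {R : realType} {d : measure_display} {T : measurableType d}
  (P : probability T R) (U : nat -> {RV P >-> R}) (alpha : R).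
Hypothesis iidU : iid_RVs U.
Hypothesis alpha_ge0 : 0 <= alpha.
Hypothesis tail_gt0 : forall x : R, x < 1 -> (0 < P [set w | (x < U 0%N w)%R])%E.
Hypothesis tail_o :
  (fun u : R => ln (tailQ P (U 0%N) (1 - u)) - alpha * ln u) =o_ (0^'+) (fun u : R => ln u).

Definition top (K : R) (N : nat) : set R := [set x | 1 - K * rate N < x].

Lemma measurable_gt (a : R) : measurable [set x : R | a < x].
Proof.
rewrite (_ : [set x : R | a < x] = `]a, +oo[%classic); first exact: measurable_itv.
by apply/seteqP; split => x /=; rewrite in_itv/= andbT.
Qed.

Lemma tail_count (K delta : R) : 0 < K -> 0 < delta ->
  \forall N \near \oo, expR (lnn N * (1 - alpha / 2 - delta)) <=
     N%:R * prob_of P U (top K N) <= expR (lnn N * (1 - alpha / 2 + delta)).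
Proof.
move=> K0 delta0.
(* The tail hypothesis costs [e] and the replacement of [L] by [- lnn N / 2] costs [alpha * e],
   which must sum to at most [delta]; [e <= 1 / 2] ensures that [L] is at most [lnn N] in absolute
   value. *)
pose e := Num.min (1 / 2) (delta / (alpha + 1)).
have a0 := alpha_ge0; have a1 : 0 < alpha + 1 by lra.
have e0 : 0 < e by rewrite /e lt_min divr_gt0//= divr_gt0.
have e1 : e <= 1 / 2 by rewrite /e ge_min lexx.
have e2 : e * (alpha + 1) <= delta.
  by rewrite -ler_pdivlMr// /e ge_min lexx orbT.
have := tail_o => /eqoP /(_ e e0) -[rho /= rho0 near0].
near=> N.
have N1 : (1 < N)%N by near: N; exists 2%N.
have n0 : 0 < N%:R :> R by rewrite ltr0n; apply: ltn_trans N1.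
have l1 : 1 <= lnn N :> R by near: N; exact: near_lnn_ge.
have r0 := @rate_gt0 R N N1.
have u0 : 0 < K * rate N by rewrite mulr_gt0.
have u1 : K * rate N <= rho / 2 by near: N; apply: near_rate_le; lra.
(* Needed to recover the probability from its logarithm, as [ln] has a default value at 0. *)
have q0 : 0 < prob_of P U (top K N).
  have mt := measurable_gt (1 - K * rate N).
  by rewrite -lte_fin -(prob_ofE P U iidU 0 _ mt); apply: tail_gt0; lra.
have := near0 (K * rate N); rewrite /ball_ /= sub0r normrN gtr0_norm// => /(_ _ u0).
move=> /(_ ltac:(lra)).
have -> : tailQ P (U 0%N) (1 - K * rate N) = prob_of P U (top K N) by [].
have : `|ln (K * rate N) + lnn N / 2| <= e * lnn N by near: N; exact: ln_rate.
set L := ln (K * rate N) => hL hq.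
have -> : N%:R * prob_of P U (top K N) = expR (lnn N + ln (prob_of P U (top K N))).
  by rewrite expRD /lnn !lnK ?posrE.
rewrite !ler_expR.
have absL : `|L| <= lnn N.
  have -> : L = (L + lnn N / 2) - lnn N / 2 by lra.
  apply: le_trans (ler_normB _ _) _.
  by rewrite (ger0_norm (_ : 0 <= lnn N / 2)); [nra|lra].
have hq' : `|ln (prob_of P U (top K N)) - alpha * L| <= e * lnn N.
  by apply: le_trans hq _; rewrite ler_wpM2l// ltW.
have haL : `|alpha * (L + lnn N / 2)| <= alpha * (e * lnn N).
  by rewrite normrM ger0_norm// ler_wpM2l.
have hd : e * (alpha + 1) * lnn N <= delta * lnn N by rewrite ler_wpM2r//; lra.
move: hq' haL; rewrite !ler_norml => /andP[b1 b2] /andP[b3 b4].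
by apply/andP; split; lra.
Unshelve. all: by end_near. Qed.

(** The targets [yl] and [yu] differ from the mean by a factor of at least 4, gained from half of
    [eta]. A constant tilt then gives an exponent of at most [- yl / 4], respectively [- yu / 4],
    which is below [- 2 * lnn N]; for [yl] this uses that [1 - alpha / 2 - eta] is positive. *)
Lemma top_count_as (K eta : R) : 0 < K -> 0 < eta -> eta < 1 - alpha / 2 ->
  {ae P, forall w, \forall N \near \oo,
     expR (lnn N * (1 - alpha / 2 - eta)) <= hits P U N (top K N) w <=
     expR (lnn N * (1 - alpha / 2 + eta))}.
Proof.
move=> K0 eta0 etar.
have mt N : measurable (top K N) by exact: measurable_gt.
pose yl N := expR (lnn N * (1 - alpha / 2 - eta)) : R.
pose yu N := expR (lnn N * (1 - alpha / 2 + eta)) : R.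
have tc := tail_count K (eta / 2) K0 ltac:(lra).
have low : {ae P, forall w, \forall N \near \oo, ~ (hits P U N (top K N) w <= yl N)}.
  apply: (borel_cantelli P (fun N => [set w | hits P U N (top K N) w <= yl N])).
    by move=> N; have [] := hits_le P U iidU N (top K N) (yl N) 0 (mt N) (lexx 0).
  near=> N.
  have [_ h] := hits_le P U iidU N (top K N) (yl N) (1 / 4) (mt N) ltac:(lra).
  apply: le_trans h _; rewrite lee_fin ler_expR.
  have [/andP[tl _]] : expR (lnn N * (1 - alpha / 2 - eta / 2)) <=
     N%:R * prob_of P U (top K N) <= expR (lnn N * (1 - alpha / 2 + eta / 2)) by near: N.
  have big : 4 <= expR (lnn N * (eta / 2)) :> R by near: N; apply: near_expR_lnn_cst; lra.
  have ly : 8 * lnn N <= yl N by near: N; apply: near_expR_lnn_ge; lra.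
  have Nq : 4 * yl N <= N%:R * prob_of P U (top K N).
    apply: le_trans tl; have -> : lnn N * (1 - alpha / 2 - eta / 2) =
      lnn N * (eta / 2) + lnn N * (1 - alpha / 2 - eta) by lra.
    by rewrite expRD ler_wpM2r// expR_ge0.
  have /expR_sub1x/andP[_ ee] : `|- (1 / 4)| <= 2^-1 :> R by rewrite normrN ger0_norm; lra.
  have ee' : expR (- (1 / 4)) - 1 <= - (1 / 8) :> R by lra.
  have : N%:R * prob_of P U (top K N) * (expR (- (1 / 4)) - 1) <=
      N%:R * prob_of P U (top K N) * - (1 / 8).
    by rewrite ler_wpM2l// mulr_ge0 ?ler0n//; have /andP[] := prob_of01 P U iidU _ (mt N).
  lra.
have up : {ae P, forall w, \forall N \near \oo, ~ (yu N <= hits P U N (top K N) w)}.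
  apply: (borel_cantelli P (fun N => [set w | yu N <= hits P U N (top K N) w])).
    by move=> N; have [] := hits_ge P U iidU N (top K N) (yu N) 0 (mt N) (lexx 0).
  near=> N.
  have [_ h] := hits_ge P U iidU N (top K N) (yu N) (1 / 2) (mt N) ltac:(lra).
  apply: le_trans h _; rewrite lee_fin ler_expR.
  have [/andP[_ tu]] : expR (lnn N * (1 - alpha / 2 - eta / 2)) <=
     N%:R * prob_of P U (top K N) <= expR (lnn N * (1 - alpha / 2 + eta / 2)) by near: N.
  have big : 4 <= expR (lnn N * (eta / 2)) :> R by near: N; apply: near_expR_lnn_cst; lra.
  have ly : 8 * lnn N <= yu N by near: N; apply: near_expR_lnn_ge; lra.
  have Nq : 4 * (N%:R * prob_of P U (top K N)) <= yu N.
    apply: (@le_trans _ _ (4 * expR (lnn N * (1 - alpha / 2 + eta / 2)))); first by rewrite ler_wpM2l.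
    rewrite /yu; have -> : lnn N * (1 - alpha / 2 + eta) =
      lnn N * (eta / 2) + lnn N * (1 - alpha / 2 + eta / 2) by lra.
    by rewrite expRD ler_wpM2r// expR_ge0.
  have /expR_sub1x/andP[_ ee] : `|1 / 2| <= 2^-1 :> R by rewrite ger0_norm; lra.
  have ee' : expR (1 / 2) - 1 <= 1 :> R by lra.
  have : N%:R * prob_of P U (top K N) * (expR (1 / 2) - 1) <=
      N%:R * prob_of P U (top K N) * 1.
    by rewrite ler_wpM2l// mulr_ge0 ?ler0n//; have /andP[] := prob_of01 P U iidU _ (mt N).
  lra.
move: low up; apply: filterS2 => w lw uw; near=> N.
have /negP h1 : ~ (hits P U N (top K N) w <= yl N) by near: N.
have /negP h2 : ~ (yu N <= hits P U N (top K N) w) by near: N.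
by rewrite -ltNge in h1; rewrite -ltNge in h2; rewrite !ltW.
Unshelve. all: by end_near. Qed.

End TailAsymptotics.

(** * The law of large numbers for the information *)

Definition info {R : realType} (x : R) : R := x / (x + 1) ^+ 2.

Section LawOfLargeNumbers.
Context {R : realType} {d : measure_display} {T : measurableType d}
  (P : probability T R) (U : nat -> {RV P >-> R}).
Hypothesis iidU : iid_RVs U.
Hypothesis U_gt0 : forall k, {ae P, forall w, 0 < U k w}.

(** The tilt [e m / 4] gives the exponent [- N * e m ^+ 2 / 8], which is summable. The accuracies
    [e m] form a countable family, so the exceptional null sets can be united. *)
Lemma freq_as (B : set R) : measurable B ->
  {ae P, forall w, hits P U N B w / N%:R @[N --> \oo] --> prob_of P U B}.
Proof.
move=> mB; set q := prob_of P U B.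
have /andP[q0 q1] : 0 <= q <= 1 := prob_of01 P U iidU B mB.
pose e (m : nat) : R := m.+1%:R^-1.
have e0 m : 0 < e m by rewrite invr_gt0 ltr0n.
have e1 m : e m <= 1 by rewrite invf_le1 ?ltr0n// ler1n.
have lam_bounds m : 0 <= e m / 4 /\ `|e m / 4| <= 2^-1 /\ `|- (e m / 4)| <= 2^-1.
  have := e0 m; have := e1 m => h1 h2.
  by rewrite normrN !ger0_norm; try split; try split; lra.
have rate_sq m : \forall N \near \oo, 2 * lnn N <= N%:R * (e m ^+ 2 / 8).
  near=> N; have N0 : (0 < N)%N by near: N; exists 1%N.
  have h : 1 * rate N <= e m / 4 by near: N; apply: near_rate_le; have := e0 m; lra.
  rewrite mul1r in h; rewrite lnn_rate// mulrCA ler_wpM2l//.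
  have : rate N ^+ 2 <= (e m / 4) ^+ 2.
    by rewrite lerXn2r ?nnegrE ?rate_ge0//; have := e0 m; lra.
  lra.
have sq_q (x : R) : 0 <= x -> q * (2 * x) <= 2 * x.
  by move=> x0; apply: ler_piMl => //; rewrite mulr_ge0.
have up m : {ae P, forall w, \forall N \near \oo, ~ (N%:R * (q + e m) <= hits P U N B w)}.
  have [l0 [l1 _]] := lam_bounds m.
  apply: (borel_cantelli P (fun N => [set w | N%:R * (q + e m) <= hits P U N B w])).
    by move=> N; have [] := hits_ge P U iidU N B (N%:R * (q + e m)) _ mB l0.
  near=> N; have [_ h] := hits_ge P U iidU N B (N%:R * (q + e m)) _ mB l0.
  apply: le_trans h _; rewrite lee_fin ler_expR -/q.
  have h1 : 2 * lnn N <= N%:R * (e m ^+ 2 / 8) by near: N; exact: rate_sq.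
  have /andP[_ h2] := expR_sub1x _ l1.
  have h3 := ler_wpM2l q0 h2; have h4 := sq_q _ (sqr_ge0 (e m / 4)).
  have h5 : q * (expR (e m / 4) - 1) - e m / 4 * (q + e m) <= - (e m ^+ 2 / 8) by lra.
  have := ler_wpM2l (ler0n R N) h5; lra.
have low m : {ae P, forall w, \forall N \near \oo, ~ (hits P U N B w <= N%:R * (q - e m))}.
  have [l0 [_ l1]] := lam_bounds m.
  apply: (borel_cantelli P (fun N => [set w | hits P U N B w <= N%:R * (q - e m)])).
    by move=> N; have [] := hits_le P U iidU N B (N%:R * (q - e m)) _ mB l0.
  near=> N; have [_ h] := hits_le P U iidU N B (N%:R * (q - e m)) _ mB l0.
  apply: le_trans h _; rewrite lee_fin ler_expR -/q.
  have h1 : 2 * lnn N <= N%:R * (e m ^+ 2 / 8) by near: N; exact: rate_sq.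
  have /andP[_ h2] := expR_sub1x _ l1.
  have h3 := ler_wpM2l q0 h2; have h4 := sq_q _ (sqr_ge0 (e m / 4)).
  have h5 : q * (expR (- (e m / 4)) - 1) + e m / 4 * (q - e m) <= - (e m ^+ 2 / 8) by lra.
  have := ler_wpM2l (ler0n R N) h5; lra.
have := ae_foralln up; have := ae_foralln low; apply: filterS2 => w lw uw.
apply/cvgrPdist_le => eps eps0.
have [m _ /(_ m (leqnn m)) /= em] : \forall m \near \oo, e m <= eps.
  by apply: filterS (near_infty_natSinv_lt (PosNum eps0)) => m /ltW.
near=> N.
have n0 : 0 < N%:R :> R by rewrite ltr0n; near: N; exists 1%N.
have /negP h1 : ~ (hits P U N B w <= N%:R * (q - e m)) by near: N; exact: lw.
have /negP h2 : ~ (N%:R * (q + e m) <= hits P U N B w) by near: N; exact: uw.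
rewrite -ltNge in h1; rewrite -ltNge in h2.
rewrite distrC ler_norml lerBrDr lerBlDr.
rewrite ler_pdivrMr// ler_pdivlMr//.
have h3 : N%:R * e m <= N%:R * eps by rewrite ler_wpM2l// ltW.
by apply/andP; split; lra.
Unshelve. all: by end_near. Qed.

Lemma info_bounds (x : R) : 0 < x -> 0 <= info x < 1.
Proof.
move=> x0; rewrite /info divr_ge0 ?sqr_ge0 ?ltW//= ltr_pdivrMr ?exprn_gt0; nra.
Qed.

Lemma measurable_info : measurable_fun setT (@info R).
Proof.
have -> : @info R = (fun x : R => x * powR `|x + 1| (- 2%:R)).
  apply/funext => x; rewrite /info powRN powR_mulrn//.
  by rewrite real_normK ?num_real.
apply: measurable_funM => //.
apply: (measurableT_comp (measurable_powR (- 2%:R))) => //.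
apply: measurableT_comp => //.
by apply: measurable_funD.
Qed.

(* Layer cake: the number of [k] such that [x] lies in [level m k] is within [1]
   of [m.+1 * info x], which reduces the law of large numbers to frequencies. *)
Definition level (m k : nat) : set R := [set x | k.+1%:R < m.+1%:R * info x].

Lemma measurable_level m k : measurable (level m k).
Proof.
rewrite (_ : level m k = (fun x => m.+1%:R * info x) @^-1` [set y | k.+1%:R < y]) //.
rewrite -[_ @^-1` _]setTI.
have mf : measurable_fun setT (fun x => m.+1%:R * info x : R).
  by apply: measurable_funM => //; exact: measurable_info.
by apply: mf => //; exact: measurable_gt.
Qed.

Lemma level_count (m : nat) (y : R) : 0 <= y -> y < m%:R ->
  \sum_(k < m) (k.+1%:R < y)%R%:R <= y <= \sum_(k < m) (k.+1%:R < y)%R%:R + 1.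
Proof.
(* The induction drops [y < m], so it must also record that the sum saturates at [m] when [y] lies
   beyond the range. *)
move=> y0 ym; suff : (\sum_(k < m) (k.+1%:R < y)%R%:R <= y) /\
   (if m%:R < y then \sum_(k < m) (k.+1%:R < y)%R%:R = m%:R :> R
    else y <= \sum_(k < m) (k.+1%:R < y)%R%:R + 1).
  by case: ltP; [lra|move=> _ [-> ->]].
elim: m {ym} => [|m [IH1 IH2]].
  by rewrite !big_ord0 add0r; split=> //; case: ifP => // /negbT; rewrite -leNgt; lra.
rewrite !big_ord_recr/=; have [my|ym] := ltP m.+1%:R y.
  have m1 : m%:R < y by apply: lt_trans my; rewrite ltr_nat.
  by move: IH2; rewrite m1 => ->; rewrite natr1; split=> //; exact: ltW.
split; first by rewrite addr0.
move: IH2; rewrite addr0; case: ifP => // _ ->.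
by rewrite natr1.
Qed.

(** The expectation of [level_count] at [m.+1 * info U], which is below [m.+1] because [info] is
    below 1 on positive reals. *)
Lemma thetaU_level m :
  \sum_(k < m.+1) prob_of P U (level m k) <= m.+1%:R * thetaU P (U 0%N) <=
  \sum_(k < m.+1) prob_of P U (level m k) + 1.
Proof.
have mU : measurable_fun setT (U 0%N) by exact: measurable_funP.
have mi : measurable_fun setT (fun w => info (U 0%N w)).
  exact: (measurableT_comp measurable_info mU).
have M0 : 0 <= m.+1%:R :> R by exact: ler0n.
pose A k := U 0%N @^-1` level m k.
have mA k : measurable (A k).
  by apply: measurable_RV_preimage; exact: measurable_level.
(* The absolute value makes the integrand nonnegative everywhere; it changes nothing almost surely,
   as [U] is positive. *)
pose I := (\int[P]_w (`|info (U 0%N w)|)%:E)%E.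
have IE : (\int[P]_w (U 0%N w / (U 0%N w + 1) ^+ 2)%:E)%E = I.
  apply: ae_eq_integral => //.
  - exact/measurable_EFinP.
  - by apply/measurable_EFinP; exact: measurableT_comp.
  - apply: filterS (U_gt0 0%N) => w w0 _; congr EFin; rewrite ger0_norm//.
    by have /andP[] := info_bounds _ w0.
pose G w := (\sum_(k < m.+1) (\1_(A k) w)%:E)%E : \bar R.
have mG : measurable_fun setT G.
  by apply: emeasurable_sum => k; apply/measurable_EFinP; exact: measurable_indic.
have G0 w : (0 <= G w)%E by apply: sume_ge0 => k _; rewrite lee_fin.
have IG : (\int[P]_w G w)%E = (\sum_(k < m.+1) prob_of P U (level m k))%:E.
  rewrite /G ge0_integral_sum//; last first.
    by move=> k; apply/measurable_EFinP; exact: measurable_indic.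
  rewrite -sumEFin; apply: eq_bigr => k _; rewrite integral_indic// setIT.
  exact: (prob_ofE P U iidU 0 _ (measurable_level m k)).
have GE w : 0 < U 0%N w -> G w = (\sum_(k < m.+1) (k.+1%:R < m.+1%:R * `|info (U 0%N w)|)%R%:R)%:E.
  move=> w0; rewrite /G sumEFin; congr EFin; apply: eq_bigr => k _.
  rewrite indicE ger0_norm; last by have /andP[] := info_bounds _ w0.
  by congr (_%:R); congr nat_of_bool; apply/idP/idP; rewrite inE.
have mI : measurable_fun setT (fun w => (m.+1%:R * `|info (U 0%N w)|)%:E : \bar R).
  by apply/measurable_EFinP; apply: measurable_funM => //; exact: measurableT_comp.
have MI : (\int[P]_w (m.+1%:R * `|info (U 0%N w)|)%:E)%E = (m.+1%:R%:E * I)%E.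
  under eq_integral do rewrite EFinM.
  rewrite ge0_integralZl_EFin//; first by apply/measurable_EFinP; exact: measurableT_comp.
have bnds w : 0 < U 0%N w ->
   (G w <= (m.+1%:R * `|info (U 0%N w)|)%:E <= G w + 1)%E.
  move=> w0; rewrite GE// -EFinD !lee_fin; apply: level_count.
    by rewrite mulr_ge0.
  have /andP[i0 i1] := info_bounds _ w0.
  by rewrite ger0_norm// -[ltRHS]mulr1 ltr_pM2l// ltr0n.
have fI0 w : [set: T] w -> (0 <= (m.+1%:R * `|info (U 0%N w)|)%:E)%E.
  by move=> _; rewrite lee_fin mulr_ge0.
have lowI : ((\sum_(k < m.+1) prob_of P U (level m k))%:E <= m.+1%:R%:E * I)%E.
  rewrite -IG -MI; apply: (ae_ge0_le_integral measurableT _ mG fI0 mI) => //.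
  by apply: filterS (U_gt0 0%N) => w w0 _; have /andP[] := bnds w w0.
have upI : (m.+1%:R%:E * I <= (\sum_(k < m.+1) prob_of P U (level m k) + 1)%:E)%E.
  rewrite EFinD -IG.
  have -> : (\int[P]_w G w + 1%:E = \int[P]_w (G w + 1%:E))%E.
    by rewrite ge0_integralD//= integral_cst//= ?probability_setT ?mul1e ?mule1.
  rewrite -MI; apply: (ae_ge0_le_integral measurableT fI0 mI) => //.
  - by move=> w _; rewrite adde_ge0.
  - exact: emeasurable_funD.
  - by apply: filterS (U_gt0 0%N) => w w0 _; have /andP[] := bnds w w0.
have I0 : (0 <= I)%E by apply: integral_ge0 => w _; rewrite lee_fin.
(* Finiteness follows from the upper bound just proved, and makes the [fine] in [thetaU]
   faithful. *)
have Ifin : I \is a fin_num.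
  rewrite ge0_fin_numE//; rewrite ltNge; apply/negP; rewrite leye_eq => /eqP IE'.
  by move: upI; rewrite IE' gt0_muley ?lte_fin ?ltr0n// leye_eq.
have -> : thetaU P (U 0%N) = fine I by rewrite -IE.
by rewrite -!lee_fin EFinM fineK// lowI upI.
Qed.

(** Discretizing at [m.+1] levels costs at most [m.+1%:R^-1], taken below [eps / 2]; the other half
    of [eps] goes to the finitely many frequencies. *)
Lemma lln_info : {ae P, forall w,
  (\sum_(k < N) info (U k w)) / N%:R @[N --> \oo] --> thetaU P (U 0%N)}.
Proof.
have freqs : {ae P, forall w, forall m k,
    hits P U N (level m k) w / N%:R @[N --> \oo] --> prob_of P U (level m k)}.
  apply: ae_foralln => m; apply: ae_foralln => k.
  by apply: freq_as; exact: measurable_level.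
have := ae_foralln U_gt0; move: freqs; apply: filterS2 => w fw w0.
apply/cvgrPdist_le => eps eps0.
have [m _ /(_ m (leqnn m)) /= em] : \forall m \near \oo, m.+1%:R^-1 <= eps / 2.
  have e20 : 0 < eps / 2 by lra.
  by apply: filterS (near_infty_natSinv_lt (PosNum e20)) => m /ltW.
have M0 : 0 < m.+1%:R :> R by rewrite ltr0n.
have /andP[t1 t2] := thetaU_level m.
set p := \sum_(k < m.+1) prob_of P U (level m k) in t1 t2.
set theta := thetaU P (U 0%N) in t1 t2 *.
pose A N := \sum_(k < m.+1) (hits P U N (level m k) w / N%:R).
have Ap : A @ \oo --> p.
  have -> : A = \sum_(k < m.+1) (fun N => hits P U N (level m k) w / N%:R).
    by apply/funext => N; rewrite fct_sumE.
  apply: (big_ind2 (fun (u : nat -> R) l => u @ \oo --> l)) => [|u l u' l'|k _].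
  - exact: cvg_cst.
  - exact: cvgD.
  - exact: fw.
near=> N.
have n0 : 0 < N%:R :> R by rewrite ltr0n; near: N; exists 1%N.
have ApN : `|p - A N| <= m.+1%:R * (eps / 2).
  by near: N; move/cvgrPdist_le: Ap; apply; rewrite mulr_gt0//; lra.
have AE : A N * N%:R = \sum_(i < N) \sum_(k < m.+1) (k.+1%:R < m.+1%:R * info (U i w))%R%:R.
  rewrite /A -mulr_suml divfK ?lt0r_neq0// /hits exchange_big/=.
  apply: eq_bigr => i _; apply: eq_bigr => k _.
  by congr (_%:R); congr nat_of_bool; apply/idP/idP; rewrite inE.
have lc i : \sum_(k < m.+1) (k.+1%:R < m.+1%:R * info (U i w))%R%:R <= m.+1%:R * info (U i w)
    <= \sum_(k < m.+1) (k.+1%:R < m.+1%:R * info (U i w))%R%:R + 1.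
  have /andP[i0 i1] := info_bounds _ (w0 i).
  apply: level_count; first by rewrite mulr_ge0// ltW.
  by rewrite -[ltRHS]mulr1 ltr_pM2l.
set S := \sum_(k < N) info (U k w).
have S1 : A N * N%:R <= m.+1%:R * S.
  by rewrite AE mulr_sumr; apply: ler_sum => i _; have /andP[] := lc i.
have S2 : m.+1%:R * S <= A N * N%:R + N%:R.
  rewrite AE mulr_sumr -[X in _ + X](_ : \sum_(i < N) 1 = N%:R); last first.
    by rewrite sumr_const card_ord.
  by rewrite -big_split; apply: ler_sum => i _; have /andP[] := lc i.
have S3 : A N <= m.+1%:R * (S / N%:R) <= A N + 1.
  by rewrite mulrA ler_pdivlMr// S1/= ler_pdivrMr// mulrDl mul1r.
have mm : 1 <= m.+1%:R * (eps / 2) by rewrite mulrC -ler_pdivrMr// mul1r.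
rewrite -(ler_pM2l M0) -[X in X * `|_|]gtr0_norm// -normrM mulrBr.
move: S3 ApN => /andP[]; rewrite !ler_norml => S3 S4 /andP[a1 a2].
apply/andP; split; lra.
Unshelve. all: by end_near. Qed.

End LawOfLargeNumbers.

(** * Symmetric functions of the order statistics *)

Section Strengths.
Context {R : realType}.
Implicit Types (u : nat -> R) (N : nat).

(** Sorting is a permutation, so a symmetric sum over the order statistics is a sum over the i.i.d.
    sample itself. *)
Lemma sum_strengths N u (vN : R) (g : R -> R) :
  \sum_(j < N.+1 | (j < N)%N) g (strengths u vN j) = \sum_(k < N) g (u k).
Proof.
set L := sort (fun a b : R => a <= b) [seq u k | k <- iota 0 N].
have sL : size L = N by rewrite size_sort size_map size_iota.
rewrite big_mkcond big_ord_recr/= ltnn addr0.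
transitivity (\sum_(j < N) g (nth 0 L j)).
  by apply: eq_bigr => j _; rewrite /strengths /= ltn_ord.
transitivity (\sum_(x <- L) g x); first by rewrite (big_nth 0) sL big_mkord.
rewrite (perm_big [seq u k | k <- iota 0 N]); last by rewrite perm_sort.
by rewrite big_map -(big_mkord xpredT (fun k => g (u k))) /index_iota subn0.
Qed.

Lemma strengths_mem N u (vN : R) (i : 'I_N.+1) : (i < N)%N ->
  exists k, strengths u vN i = u k.
Proof.
move=> iN; rewrite /strengths iN; set L := sort _ _.
have : nth 0 L i \in L by rewrite mem_nth// size_sort size_map size_iota.
by rewrite mem_sort => /mapP[k _ ->]; exists k.
Qed.

Lemma strengths_max N u (vN : R) : strengths u vN (ord_max : 'I_N.+1) = vN.
Proof. by rewrite /strengths ltnn. Qed.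

Lemma card_strong_players N u (vN r K : R) :
  #|strong_players (strengths u vN : 'I_N.+1 -> R) r K|%:R =
  \sum_(k < N) (1 - K * r < u k)%R%:R :> R.
Proof.
rewrite -(sum_strengths N u vN (fun y => (1 - K * r < y)%R%:R)).
rewrite -sum1_card natr_sum big_mkcondr/=.
by apply: eq_bigr => i _; case: ifP.
Qed.

End Strengths.

(** * Eventual bounds from the inferior and superior limits *)

Section LimitInferior.
Context {R : realType} (u : nat -> R).

(** The inferior limit is the supremum of the tail infima, so some tail infimum exceeds [a] and
    serves as [c]; it is finite, lying above [a] and below a real term. *)
Lemma limn_einf_gt (a : R) : (a%:E < limn_einf (fun N => (u N)%:E))%E ->
  exists2 c, a < c & \forall N \near \oo, c <= u N.
Proof.
have sup_lim := @cvg_einfs_sup R (fun N => (u N)%:E).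
rewrite limn_einf_lim (cvg_lim _ sup_lim)// => /ereal_sup_gt[_ [n _ <-]] an.
have le_u k : (n <= k)%N -> (einfs (fun N => (u N)%:E) n <= (u k)%:E)%E.
  by move=> nk; apply: ereal_inf_lbound; exists k.
have fin : einfs (fun N => (u N)%:E) n \is a fin_num.
  rewrite fin_numE; apply/andP; split.
    by apply/eqP => E; move: an; rewrite E.
  by apply/eqP => E; have := le_u n (leqnn n); rewrite E.
exists (fine (einfs (fun N => (u N)%:E) n)); first by rewrite -lte_fin fineK.
by exists n => // k /= /le_u; rewrite -[X in (X <= _)%E]fineK// lee_fin.
Qed.

End LimitInferior.

Lemma limn_esup_lt {R : realType} (u : nat -> R) (a : R) :
  (limn_esup (fun N => (u N)%:E) < a%:E)%E ->
  exists2 c, c < a & \forall N \near \oo, u N <= c.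
Proof.
move=> h; have [|c ac uc] := limn_einf_gt (fun N => - u N) (- a).
  have -> : limn_einf (fun N => (- u N)%:E) = (- limn_esup (fun N => (u N)%:E))%E.
    exact: (limn_einfN (fun N => (u N)%:E)).
  by rewrite EFinN lteN2.
exists (- c); first by rewrite ltrNl.
by apply: filterS uc => N; rewrite lerNr.
Qed.

(** On (1/2, 1] one has [8 * info x > 1], so the lowest of the 8 levels has positive probability,
    and [thetaU_level] bounds [8 * thetaU] below by it. *)
Lemma thetaU_gt0 {R : realType} {d : measure_display} {T : measurableType d}
  (P : probability T R) (U : nat -> {RV P >-> R}) : iid_RVs U ->
  (forall k, {ae P, forall w, 0 < U k w}) ->
  P [set w | 1 < U 0%N w] = 0%E ->
  (forall x : R, x < 1 -> (0 < P [set w | (x < U 0%N w)%R])%E) ->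
  0 < thetaU P (U 0%N).
Proof.
move=> iidU U0 U1 tail.
have mlt a : measurable [set w | a < U 0%N w].
  exact: (measurable_RV_preimage P (U 0%N) _ (measurable_gt a)).
have ml k : measurable (level 7 k : set R) by exact: measurable_level.
have /andP[low _] := thetaU_level P U iidU U0 7.
have q0 : 0 < prob_of P U (level 7 0).
  rewrite -lte_fin -(prob_ofE P U iidU 0 _ (ml 0%N)).
  apply: lt_le_trans (tail (1 / 2) _) _; first lra.
  have mA : measurable (U 0%N @^-1` level 7 0).
    exact: measurable_RV_preimage.
  apply: (@le_trans _ _ (P ((U 0%N @^-1` level 7 0) `|` [set w | 1 < U 0%N w]))).
    apply: le_measure; rewrite ?inE//; first exact: measurableU.
    move=> w /= w2; have [w1|w1] := lerP (U 0%N w) 1; last by right.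
    left; rewrite /level/= /info mulrA ltr_pdivlMr ?exprn_gt0//; nra.
  apply: le_trans (measureU2 _ mA (mlt 1)) _.
  by rewrite [X in (_ + X <= _)%E](_ : _ = 0%E) ?adde0//; exact: U1.
have : prob_of P U (level 7 0) <= \sum_(k < 8) prob_of P U (level 7 k).
  rewrite big_ord_recl lerDl; apply: sumr_ge0 => k _.
  by have /andP[] := prob_of01 P U iidU _ (ml (bump 0 k)).
lra.
Qed.

(** * Transfer of the deterministic limits to almost every realization *)

Theorem theorem3 (R : realType) (d : measure_display) (T : measurableType d)
  (P : probability T R) (U : nat -> {RV P >-> R}) (alpha : R) (v : nat -> R) :
  iid_RVs U ->
  (forall k, {ae P, forall w, 0 < U k w}) ->
  (* the maximum of the support of the law of U is 1 *)
  P [set w | 1 < U 0%N w] = 0%E ->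
  (forall x : R, x < 1 -> (0 < P [set w | (x < U 0%N w)%R])%E) ->
  0 <= alpha -> alpha < 2 ->
  (* log Q(1-u) = alpha log u + o(log u) as u -> 0+ *)
  (fun u : R => ln (tailQ P (U 0%N) (1 - u)) - alpha * ln u) =o_ (0^'+) (fun u : R => ln u) ->
  (forall N, (0 < N)%N -> 0 < v N) ->
  let eps := epsN alpha (thetaU P (U 0%N)) in
  let V := fun (N : nat) (w : T) => @strengths R N (fun k => U k w) (v N) in
  ((1 < limn_einf (fun N => ((v N - 1) / eps N)%:E))%E ->
     {ae P, forall w,
        (forall N, (0 < N)%N -> qprob (V N w) (@strong_win N) <= qprob (V N w) (@wins N)) /\
        (fun N => qprob (V N w) (@strong_win N)) @ \oo --> (1 : R)}) /\
  ((limn_esup (fun N => ((v N - 1) / eps N)%:E) < 1)%E ->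
     {ae P, forall w,
        (forall N, (0 < N)%N -> qprob (V N w) (@strong_lose N) <= qprob (V N w) (@not_wins N)) /\
        (fun N => qprob (V N w) (@strong_lose N)) @ \oo --> (1 : R)}).
Proof.
move=> iidU U_gt0 U_le1 tail_gt0 alpha0 alpha2 tail_o v_gt0 eps V.
set theta := thetaU P (U 0%N) in eps *.
have theta0 : 0 < theta by exact: thetaU_gt0.
pose rho := 1 - alpha / 2; pose e0 := Num.sqrt ((2 - alpha) / theta).
have e00 : 0 < e0 by rewrite sqrtr_gt0 divr_gt0// subr_gt0.
have e0E : e0 ^+ 2 * theta = 2 * rho.
  rewrite sqr_sqrtr; last by rewrite divr_ge0 ?subr_ge0// ltW.
  by rewrite divfK ?lt0r_neq0// /rho; lra.
have rho0 : 0 < rho by rewrite /rho; lra.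
have epsE N : eps N = e0 * rate N.
  by rewrite /eps /epsN sqrtrM// divr_ge0 ?subr_ge0// ltW.
(* For [N] at most 1, [eps N] is 0 and the quotients in the hypotheses have a default value; only
   large [N] count. *)
have eps_gt0 : \forall N \near \oo, 0 < eps N.
  by exists 2%N => // N N2; rewrite epsE mulr_gt0// rate_gt0.
(* Identical distribution carries the null set of [U 0] over to each [U k]. *)
have U_le1_as : {ae P, forall w, forall k, U k w <= 1}.
  apply: ae_foralln => k; exists [set w | 1 < U k w]; split.
  - exact: (measurable_RV_preimage P (U k) _ (measurable_gt 1)).
  - by have := iidU.2 k _ (measurable_gt 1); rewrite U_le1.
  - by move=> w /=; rewrite leNgt => /negP; rewrite negbK.
have U_gt0_as := ae_foralln U_gt0.
have lln := lln_info P U iidU U_gt0.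
have V_gt0 w : (forall k, 0 < U k w) -> forall N i, (0 < N)%N -> 0 < V N w i.
  move=> w0 N i N0; have [iN|Ni] := ltnP i N.
    by rewrite /V; have [k ->] := strengths_mem N (fun k => U k w) (v N) i iN.
  by rewrite /V /strengths ltnNge Ni/=; exact: v_gt0.
have V_le1 w : (forall k, U k w <= 1) ->
    forall N (i : 'I_N.+1), (i < N)%N -> V N w i <= 1.
  by move=> w1 N i iN; rewrite /V; have [k ->] := strengths_mem N (fun k => U k w) (v N) i iN.
have V_info w : (\sum_(k < N) info (U k w)) / N%:R @[N --> \oo] --> theta ->
    (fun N => strength_info (V N w) / N%:R) @ \oo --> theta.
  apply: cvg_trans; apply: near_eq_cvg; apply: nearW => N /=; congr (_ / _).
  by rewrite -(sum_strengths N (fun k => U k w) (v N) info).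
have card_hits w N K : #|strong_players (V N w) (rate N) K|%:R = hits P U N (top K N) w.
  rewrite /V card_strong_players /hits; apply: eq_bigr => k _.
  by congr (_%:R); congr nat_of_bool; apply/idP/idP; rewrite inE.
split.
- move=> /limn_einf_gt[c0 c01 v_ge0].
  (* Capping [c] keeps the slack [(c' ^+ 2 - 1) * rho / 2] below [rho], as [top_count_as]
     requires. *)
  pose c := Num.min c0 2.
  have c1 : 1 < c by rewrite /c lt_min c01; lra.
  have c2 : c <= 2 by rewrite /c ge_min lexx orbT.
  have v_ge : \forall N \near \oo, 1 + c * e0 * rate N <= v N.
    near=> N; have eN : 0 < eps N by near: N.
    have : c0 <= (v N - 1) / eps N by near: N.
    rewrite ler_pdivlMr// => h.
    have : c * eps N <= c0 * eps N by rewrite ler_wpM2r ?(ltW eN)// /c ge_min lexx.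
    rewrite epsE in h *; lra.
  pose c' := (1 + c) / 2.
  have c'1 : 0 < c' ^+ 2 - 1 by rewrite /c' expr2; nra.
  have c'2 : c' ^+ 2 - 1 < 2 by rewrite /c' expr2; nra.
  have eta0 : 0 < (c' ^+ 2 - 1) * rho / 2 by rewrite divr_gt0// mulr_gt0.
  have eta1 : (c' ^+ 2 - 1) * rho / 2 < rho by nra.
  have K0 : 0 < 3 / theta by rewrite divr_gt0.
  have cnt := top_count_as P U alpha iidU alpha0 tail_gt0 tail_o _ _ K0 eta0 eta1.
  near=> w.
  have w0 : forall k, 0 < U k w by near: w.
  have w1 : forall k, U k w <= 1 by near: w.
  split.
    by move=> N N0; apply: qprob_le => [i|x]; [exact: V_gt0|exact: strong_win_wins].
  apply: (upper_limit (fun N => V N w) theta e0 rho (V_gt0 w w0) (V_le1 w w1)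
    theta0 e00 e0E _ c c1).
  + by apply: V_info; near: w.
  + have : \forall N \near \oo, expR (lnn N * (1 - alpha / 2 - (c' ^+ 2 - 1) * rho / 2)) <=
       hits P U N (top (3 / theta) N) w <= expR (lnn N * (1 - alpha / 2 + (c' ^+ 2 - 1) * rho / 2)).
      by near: w.
    by apply: filterS => N /andP[_]; rewrite card_hits.
  + by apply: filterS v_ge => N; rewrite /V strengths_max.
- move=> /limn_esup_lt[c0 c01 v_le0].
  (* [c0] may be negative or zero, whereas [lower_limit] needs a positive [c]. *)
  pose c := Num.max c0 (1 / 2).
  have c_gt0 : 0 < c by rewrite /c lt_max; apply/orP; right; lra.
  have c1 : 0 < c < 1 by rewrite c_gt0 /c gt_max c01; lra.
  have v_le : \forall N \near \oo, v N <= 1 + c * e0 * rate N.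
    near=> N; have eN : 0 < eps N by near: N.
    have : (v N - 1) / eps N <= c0 by near: N.
    rewrite ler_pdivrMr// => h.
    have : c0 * eps N <= c * eps N by rewrite ler_wpM2r ?(ltW eN)// /c le_max lexx.
    rewrite epsE in h *; lra.
  pose g := (1 - c) / 2 * (e0 * theta).
  pose K := g / (10 * theta).
  pose eta := ((e0 * theta) ^+ 2 - (e0 * theta - g / 2) ^+ 2) / (4 * theta).
  have et0 : 0 < e0 * theta by rewrite mulr_gt0.
  have g0 : 0 < g by rewrite mulr_gt0// divr_gt0//; case/andP: c1; lra.
  have gT : g < e0 * theta by rewrite /g gtr_pMl//; case/andP: c1; lra.
  have K0 : 0 < K by rewrite divr_gt0// mulr_gt0.
  have eta0 : 0 < eta by rewrite divr_gt0 ?mulr_gt0//; nra.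
  have eta1 : eta < rho.
    rewrite /eta ltr_pdivrMr ?mulr_gt0//.
    have -> : rho * (4 * theta) = 2 * (e0 * theta) ^+ 2.
      have -> : rho = e0 ^+ 2 * theta / 2 by rewrite e0E; lra.
      by field.
    by have := sqr_ge0 (e0 * theta - g / 2); have := exprn_gt0 2 et0; lra.
  have cnt := top_count_as P U alpha iidU alpha0 tail_gt0 tail_o K eta K0 eta0 eta1.
  near=> w.
  have w0 : forall k, 0 < U k w by near: w.
  have w1 : forall k, U k w <= 1 by near: w.
  split.
    by move=> N N0; apply: qprob_le => [i|x]; [exact: V_gt0|exact: strong_lose_not_wins].
  apply: (lower_limit (fun N => V N w) theta e0 rho (V_gt0 w w0) (V_le1 w w1)
    theta0 e00 e0E _ c c1).
  + by apply: V_info; near: w.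
  + have : \forall N \near \oo, expR (lnn N * (1 - alpha / 2 - eta)) <=
       hits P U N (top K N) w <= expR (lnn N * (1 - alpha / 2 + eta)) by near: w.
    by apply: filterS => N /andP[h _]; rewrite card_hits.
  + by apply: filterS v_le => N; rewrite /V strengths_max.
Unshelve. all: by end_near. Qed.
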